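(* Let $(G,H)$ be a rooted graph, and write $\mu=\mu_{G,H}$, $\Phi=\Phi_{G,H}$, $X_{\mathbf{x}}=X_{G,H}(\mathbf{x})$. For all $p=p(n)\in[0,1]$: (i) If $\Phi=\Omega(1)$ and $t=t(n)>0$ satisfies $(t/\mu)^2\Phi\ge n^{\Omega(1)}$, then $\lim_{n\to\infty}\Pr\big(\max_{\mathbf{x}\in[n]_{v_G}}|X_{\mathbf{x}}-\mu|<t\big)=1$. (ii) If $\varepsilon=\varepsilon(n)\in(0,1]$ and either (a) $\Phi(1-p)\to\infty$ and $\varepsilon^2\Phi/(1-p)\to0$, or (b) $\Phi\to0$, then $\lim_{n\to\infty}\Pr\big(\max_{\mathbf{x}\in[n]_{v_G}}|X_{\mathbf{x}}-\mu|\ge\varepsilon\mu\big)=1$.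
   Context: $\mathbb{G}_{n,p}$ is the binomial random graph on $[n]=\{1,\dots,n\}$. For a graph $F$, $v_F,e_F$ are its numbers of vertices and edges. A rooted graph $(G,H)$ consists of a graph $H$ and an induced subgraph $G\subseteq H$ with labeled root vertices $V(G)=\{1,\dots,v_G\}$, with $e_H>e_G$. $[n]_{v_G}$ is the set of tuples $\mathbf{x}=(x_1,\dots,x_{v_G})$ of distinct vertices of $[n]$. A $(G,H)$-extension of $\mathbf{x}$ is a copy of $(V(H),E(H)\setminus E(G))$ in which each $j\in V(G)$ is mapped onto $x_j$ (counted as subgraphs). $X_{G,H}(\mathbf{x})$ is the number of $(G,H)$-extensions of $\mathbf{x}$ in $\mathbb{G}_{n,p}$ and $\mu_{G,H}=\mathbb{E}X_{G,H}(\mathbf{x})$. $\Phi_{G,H}=\min\{\mu_{G,J}: G\subseteq J\subseteq H,\ e_J>e_G\}$. $\Phi=\Omega(1)$ means $\Phi$ is bounded below by a positive constant; $a\ge n^{\Omega(1)}$ means $a\ge n^{c}$ for some constant $c>0$ and all large $n$. *)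

(* Defs.v *)
From HB Require Import structures.
From mathcomp Require Import all_boot all_order all_algebra.
From mathcomp Require Import all_classical all_reals all_analysis.
Set Implicit Arguments. Unset Strict Implicit. Unset Printing Implicit Defensive.
Import Order.TTheory GRing.Theory Num.Theory.
Import numFieldNormedType.Exports.
Local Open Scope ring_scope.

Definition pairs (n : nat) : {set {set 'I_n}} := [set e : {set 'I_n} | #|e| == 2%N].

Definition gnp_weight (R : realType) (n : nat) (p : R) (E : {set {set 'I_n}}) : R :=
  p ^+ #|E| * (1 - p) ^+ (#|pairs n| - #|E|).

Definition gnp_expect (R : realType) (n : nat) (p : R) (f : {set {set 'I_n}} -> R) : R :=
  \sum_(E : {set {set 'I_n}} | E \subset pairs n) gnp_weight p E * f E.

Definition gnp_prob (R : realType) (n : nat) (p : R) (A : pred {set {set 'I_n}}) : R :=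
  gnp_expect p (fun E => (A E)%:R).

(* H is a graph on 'I_(vG + m); the roots V(G) = {1..vG} are the vertices lshift m j,
   j : 'I_vG (root j is "vertex j+1" of the paper); G is the induced subgraph on the roots. *)

Definition roots (vG m : nat) : {set 'I_(vG + m)} := [set lshift m j | j : 'I_vG].

Definition root_edges (vG m : nat) (EH : {set {set 'I_(vG + m)}}) : {set {set 'I_(vG + m)}} :=
  [set e in EH | e \subset roots vG m].

Definition rooted_graph (vG m : nat) (EH : {set {set 'I_(vG + m)}}) : bool :=
  (EH \subset pairs (vG + m)) && (#|root_edges EH| < #|EH|)%N.

(* J = (S, F) with G ⊆ J ⊆ H and e_J > e_G (V(J) = S, E(J) = F) *)
Definition sub_rooted (vG m : nat) (EH : {set {set 'I_(vG + m)}})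
  (J : {set 'I_(vG + m)} * {set {set 'I_(vG + m)}}) : bool :=
  [&& roots vG m \subset J.1, root_edges EH \subset J.2, J.2 \subset EH,
      [forall e in J.2, e \subset J.1] & (#|root_edges EH| < #|J.2|)%N].

Definition edge_img (k n : nat) (phi : 'I_k -> 'I_n) (F : {set {set 'I_k}}) : {set {set 'I_n}} :=
  (fun e : {set 'I_k} => phi @: e) @: F.

(* The set of (G,J)-extensions of x present in the graph with edge set Gam, each extension
   recorded as a subgraph (vertex set, edge set): images of (V(J), E(J) \ E(G)) under maps
   phi that are injective on V(J) and send root j to x j. *)
Definition extensions (vG m : nat) (EH : {set {set 'I_(vG + m)}})
  (J : {set 'I_(vG + m)} * {set {set 'I_(vG + m)}})
  (n : nat) (x : {ffun 'I_vG -> 'I_n}) (Gam : {set {set 'I_n}})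
  : {set {set 'I_n} * {set {set 'I_n}}} :=
  [set ((phi @: J.1), edge_img phi (J.2 :\: root_edges EH))
   | phi : {ffun 'I_(vG + m) -> 'I_n} &
     [&& [forall i in J.1, forall j in J.1, (phi i == phi j) ==> (i == j)],
         [forall j : 'I_vG, phi (lshift m j) == x j] &
         edge_img phi (J.2 :\: root_edges EH) \subset Gam]].

Definition Xext (R : realType) (vG m : nat) (EH : {set {set 'I_(vG + m)}})
  (J : {set 'I_(vG + m)} * {set {set 'I_(vG + m)}})
  (n : nat) (x : {ffun 'I_vG -> 'I_n}) (Gam : {set {set 'I_n}}) : R :=
  (#|extensions EH J x Gam|)%:R.

(* mu_{G,J} = E X_{G,J}(x), evaluated at a fixed tuple x of distinct vertices
   (independent of x by symmetry); 0 if [n]_{v_G} is empty. *)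
Definition mu_ext (R : realType) (vG m : nat) (EH : {set {set 'I_(vG + m)}})
  (J : {set 'I_(vG + m)} * {set {set 'I_(vG + m)}}) (n : nat) (p : R) : R :=
  if [pick x : {ffun 'I_vG -> 'I_n} | injectiveb x] is Some x
  then gnp_expect p (fun Gam => Xext R EH J x Gam) else 0.

Definition fullJ (vG m : nat) (EH : {set {set 'I_(vG + m)}})
  : {set 'I_(vG + m)} * {set {set 'I_(vG + m)}} := ([set: 'I_(vG + m)], EH).

Definition muGH (R : realType) (vG m : nat) (EH : {set {set 'I_(vG + m)}}) (n : nat) (p : R) : R :=
  mu_ext EH (fullJ EH) n p.

Definition XGH (R : realType) (vG m : nat) (EH : {set {set 'I_(vG + m)}})
  (n : nat) (x : {ffun 'I_vG -> 'I_n}) (Gam : {set {set 'I_n}}) : R :=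
  Xext R EH (fullJ EH) x Gam.

(* Phi_{G,H} = min { mu_{G,J} : G ⊆ J ⊆ H, e_J > e_G }; J = H is admissible,
   so using mu_{G,H} as the seed of the min is harmless. *)
Definition PhiGH (R : realType) (vG m : nat) (EH : {set {set 'I_(vG + m)}}) (n : nat) (p : R) : R :=
  \big[Num.min/muGH EH n p]_(J | sub_rooted EH J) mu_ext EH J n p.

(* Main.v *)
Require Import Defs.
From HB Require Import structures.
From mathcomp Require Import all_boot all_order fingroup perm all_algebra.
From mathcomp Require Import all_classical all_reals all_analysis.
From mathcomp Require Import fintype finset ring lra.
Set Implicit Arguments. Unset Strict Implicit. Unset Printing Implicit Defensive.
Import Order.TTheory GRing.Theory Num.Theory.
Import numFieldNormedType.Exports.
Local Open Scope ring_scope.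

(* Write X' for the centred count of one rooted tuple x, a sum of centred indicators of copies,
   and call two copies neighbours when they share an edge. Everything rests on two estimates.
   Rooted copies of any J inside H are permuted transitively by the permutations of [n] fixing x,
   so every copy of J lies in at most C |copies of H| / |copies of J| copies of H. Hence, given
   boundedly many copies with edge union D, the sum of p^|E(c) - D| over the copies c touching D
   is O(mu / Phi). Conversely Cauchy-Schwarz over the copies of the minimizing J gives
   Var X' >= (1 - p) mu^2 / Phi.

   (i) Let Y_a be the part of X' due to the neighbours of a. As I'_a is centred and independent
   of X' - Y_a, E X'^(2k) = sum_a E I'_a (X'^(2k-1) - (X' - Y_a)^(2k-1)), which bounds the
   moment recursively by O((mu^2 / Phi)^k); Markov and a union bound over x finish.

   (ii a) The same identity with a bounded C^1 function f in place of the power gives Stein's identity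
   E X' f(X') ~ Var(X') E f'(X'). With f(z) = d h(z/d) and h(z) = z / (1 + |z|), the left side
   is at most d sqrt(Var X') and f' >= 1/4 on [-d, d], so P(|X'| < d) = O(d / sqrt(Var X')) up to
   an error of order (Phi (1 - p))^(-1/2); no central limit theorem is needed.

   (ii b) The minimizing J, hence also H, has no copy with high probability. *)

(** * Expectations over a random subset *)

(** For [N = pairs n] this unfolds to [gnp_expect]. A general ground set [N] is allowed so that it
    can be split into disjoint pieces. *)
Definition rsexpect (R : realFieldType) (T : finType) (N : {set T}) (p : R)
    (f : {set T} -> R) : R :=
  \sum_(E : {set T} | E \subset N) p ^+ #|E| * (1 - p) ^+ (#|N| - #|E|) * f E.

Lemma set_ind_add (T : finType) (P : {set T} -> Prop) :
  P set0 -> (forall (a : T) (A : {set T}), a \notin A -> P A -> P (a |: A)) -> forall A, P A.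
Proof.
move=> P0 PU A; have [k] := ubnP #|A|; elim: k A => // k IH A.
have [->|[a aA]] := set_0Vmem A => // cA; rewrite -(setD1K aA).
by apply: PU; rewrite ?setD11 //; apply: IH; rewrite (cardsD1 a) aA in cA.
Qed.

Section RandomSubset.
Variables (R : realFieldType) (T : finType) (p : R).
Implicit Types (N A B D E S : {set T}) (f g : {set T} -> R).

Lemma eq_rsexpect N f g : (forall E, E \subset N -> f E = g E) ->
  rsexpect N p f = rsexpect N p g.
Proof. by move=> fg; apply: eq_bigr => E /fg ->. Qed.

Lemma rsexpectD N f g :
  rsexpect N p (fun E => f E + g E) = rsexpect N p f + rsexpect N p g.
Proof. by rewrite -big_split; apply: eq_bigr => E _; rewrite mulrDr. Qed.

Lemma rsexpectZ N a f : rsexpect N p (fun E => a * f E) = a * rsexpect N p f.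
Proof. by rewrite mulr_sumr; apply: eq_bigr => E _; rewrite mulrCA. Qed.

Lemma rsexpectZr N a f : rsexpect N p (fun E => f E * a) = rsexpect N p f * a.
Proof. by rewrite mulr_suml; apply: eq_bigr => E _; rewrite mulrA. Qed.

Lemma rsexpectB N f g :
  rsexpect N p (fun E => f E - g E) = rsexpect N p f - rsexpect N p g.
Proof.
rewrite rsexpectD; congr (_ + _); rewrite -mulN1r -rsexpectZ.
by apply: eq_rsexpect => E _; rewrite mulN1r.
Qed.

Lemma rsexpect_sum N (I : finType) (P : pred I) (F : I -> {set T} -> R) :
  rsexpect N p (fun E => \sum_(i | P i) F i E) = \sum_(i | P i) rsexpect N p (F i).
Proof. by rewrite exchange_big; apply: eq_bigr => E _; rewrite mulr_sumr. Qed.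

(** Fubini: a subset of a disjoint union is a pair of subsets, recovered by intersecting with [A]
    and [B], and the weight factors accordingly. *)
Lemma rsexpect_setU A B f : [disjoint A & B] ->
  rsexpect (A :|: B) p f =
  rsexpect A p (fun E1 => rsexpect B p (fun E2 => f (E1 :|: E2))).
Proof.
move=> dAB; rewrite /rsexpect.
under [RHS]eq_bigr do rewrite big_distrr /=.
rewrite pair_big /=.
rewrite (reindex_onto (fun u : {set T} * {set T} => u.1 :|: u.2)
  (fun E => (E :&: A, E :&: B))) /=; last first.
  by move=> E sE; rewrite -setIUr; apply/setIidPl.
apply: eq_big => [[E1 E2]|[E1 E2]] /=.
  apply/idP/idP.
    by case/andP=> _ /eqP [<- <-]; rewrite !subsetIr.
  case/andP=> s1 s2; rewrite setUSS //=; apply/eqP.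
  have d1 : E1 :&: B = set0.
    by apply/eqP; rewrite setI_eq0; apply: disjointWl dAB.
  have d2 : E2 :&: A = set0.
    by apply/eqP; rewrite setI_eq0 disjoint_sym; apply: disjointWr dAB.
  by rewrite !setIUl d1 d2 setU0 set0U (setIidPl s1) (setIidPl s2).
case/andP=> _ /eqP [e1 e2].
have s1 : E1 \subset A by rewrite -e1 subsetIr.
have s2 : E2 \subset B by rewrite -e2 subsetIr.
have d12 : [disjoint E1 & E2] by apply: disjointWl s1 (disjointWr s2 dAB).
have cU (X Y : {set T}) : [disjoint X & Y] -> #|X :|: Y| = (#|X| + #|Y|)%N.
  by rewrite -setI_eq0 cardsU => /eqP->; rewrite cards0 subn0.
rewrite !cU // exprD.
have -> : (#|A| + #|B| - (#|E1| + #|E2|) = (#|A| - #|E1|) + (#|B| - #|E2|))%N.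
  have := subset_leq_card s1; have := subset_leq_card s2.
  by move=> h2 h1; rewrite subnDA addnC -addnBA // addnC addnBA.
by rewrite exprD; ring.
Qed.

Lemma rsexpect_set0 f : rsexpect set0 p f = f set0.
Proof.
rewrite /rsexpect (big_pred1 set0); last by move=> E; rewrite subset0.
by rewrite cards0 !expr0 !mul1r.
Qed.

Lemma rsexpect_set1 a f :
  rsexpect [set a] p f = p * f [set a] + (1 - p) * f set0.
Proof.
rewrite /rsexpect (bigD1 [set a]) //= (bigD1 set0) /=; last first.
  by rewrite sub0set eq_sym -card_gt0 cards1.
rewrite big1 ?addr0; last first.
  by move=> E; rewrite subset1 => /andP[/andP[/orP[]->]].
by rewrite cards1 cards0 subnn subn0 !expr1 !expr0 mulr1 mul1r.
Qed.

Lemma rsexpect1 N : rsexpect N p (fun=> 1) = 1.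
Proof.
elim/set_ind_add: N => [|a N aN IH]; first exact: rsexpect_set0.
rewrite rsexpect_setU ?disjoints1 // rsexpect_set1 IH; ring.
Qed.

Lemma rsexpect_cst N a : rsexpect N p (fun=> a) = a.
Proof.
rewrite -[RHS]mulr1 -(rsexpect1 N) -rsexpectZ.
by apply: eq_rsexpect => E _; rewrite mulr1.
Qed.

(** Split [N] into its parts inside and outside [D]. Then [f] depends on the first part only and [g]
    on the second, so the iterated expectation factors. *)
Lemma rsexpect_indep N D f g :
  (forall E, E \subset N -> f E = f (E :&: D)) ->
  (forall E, E \subset N -> g E = g (E :\: D)) ->
  rsexpect N p (fun E => f E * g E) = rsexpect N p f * rsexpect N p g.
Proof.
move=> fD gD; rewrite -(setID N D).
have dND : [disjoint N :&: D & N :\: D].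
  by rewrite -setI_eq0; apply/eqP/setP=> i; rewrite !inE; case: (i \in D); rewrite ?andbF.
have key F : rsexpect (N :&: D :|: N :\: D) p F =
    rsexpect (N :&: D) p (fun E1 => rsexpect (N :\: D) p (fun E2 => F (E1 :|: E2))).
  exact: rsexpect_setU.
have red E1 E2 : E1 \subset N :&: D -> E2 \subset N :\: D ->
    [/\ E1 :|: E2 \subset N, (E1 :|: E2) :&: D = E1 & (E1 :|: E2) :\: D = E2].
  rewrite subsetI subsetD => /andP[s1 s1'] /andP[s2 s2']; split.
  - by rewrite subUset s1.
  - rewrite setIUl (setIidPl s1') (_ : E2 :&: D = set0) ?setU0 //.
    by apply/eqP; rewrite setI_eq0.
  - rewrite setDUl (_ : E1 :\: D = set0) ?set0U; first exact/setDidPl.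
    by apply/eqP; rewrite setD_eq0.
have eF : rsexpect (N :&: D :|: N :\: D) p f = rsexpect (N :&: D) p f.
  rewrite key; apply: eq_rsexpect => E1 s1; rewrite -[RHS](rsexpect_cst (N :\: D)).
  by apply: eq_rsexpect => E2 s2; have [s e _] := red _ _ s1 s2; rewrite fD // e.
have eG : rsexpect (N :&: D :|: N :\: D) p g = rsexpect (N :\: D) p g.
  rewrite key -[RHS](rsexpect_cst (N :&: D)); apply: eq_rsexpect => E1 s1.
  by apply: eq_rsexpect => E2 s2; have [s _ e] := red _ _ s1 s2; rewrite gD // e.
rewrite eF eG key -rsexpectZr; apply: eq_rsexpect => E1 s1; rewrite -rsexpectZ.
apply: eq_rsexpect => E2 s2; have [s e1 e2] := red _ _ s1 s2.
by rewrite fD // gD // e1 e2.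
Qed.

Lemma rsexpect_contains N S : S \subset N ->
  rsexpect N p (fun E => (S \subset E)%:R) = p ^+ #|S|.
Proof.
move=> sSN; rewrite -(setID N S) (setIidPr sSN) rsexpect_setU; last first.
  by rewrite -setI_eq0; apply/eqP/setP=> i; rewrite !inE; case: (i \in S).
rewrite [LHS](_ : _ = rsexpect S p (fun E => (S \subset E)%:R)); last first.
  apply: eq_rsexpect => E1 s1; rewrite -[RHS](rsexpect_cst (N :\: S)).
  apply: eq_rsexpect => E2 s2; congr ((nat_of_bool _)%:R); apply/idP/idP; last first.
    by move/subset_trans; apply; apply: subsetUl.
  move/subsetP => h; apply/subsetP => i iS; have := h i iS.
  by rewrite in_setU => /orP[//|/(subsetP s2)]; rewrite inE iS.
rewrite /rsexpect (bigD1 S) //= subxx mulr1 subnn expr0 mulr1 big1 ?addr0 //.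
move=> E /andP[sE nE]; rewrite (_ : S \subset E = false) ?mulr0 //.
by apply: contraNF nE => sS; rewrite eqEsubset sE.
Qed.

Hypothesis hp : 0 <= p <= 1.

Lemma le_rsexpect N f g : (forall E, E \subset N -> f E <= g E) ->
  rsexpect N p f <= rsexpect N p g.
Proof.
case/andP: hp => p0 p1 fg; apply: ler_sum => E /fg; apply: ler_wpM2l.
by rewrite mulr_ge0 ?exprn_ge0 // subr_ge0.
Qed.

Lemma rsexpect_ge0 N f : (forall E, E \subset N -> 0 <= f E) -> 0 <= rsexpect N p f.
Proof. by move=> f0; rewrite -(rsexpect_cst N 0); apply: le_rsexpect. Qed.

End RandomSubset.

(** * Sums of centred indicators *)

Section Counts.
Variables (R : realFieldType) (T U : finType) (N : {set T}) (p : R).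
Hypothesis hp : 0 <= p <= 1.
Variables (A : {set U}) (S : U -> {set T}).
Hypothesis hS : forall a, a \in A -> S a \subset N.

Local Notation Ex := (rsexpect N p).

(* In the notation of the header [cind a] is I'_a, [ccount] is X' and [cnear (S a)] is Y_a;
   [absind] and [absnear] majorize the absolute values of [cind] and [cnear]. *)
Definition prob1 (a : U) : R := p ^+ #|S a|.
Definition ind (D E : {set T}) : R := (D \subset E)%:R.
Definition cind (a : U) (E : {set T}) : R := ind (S a) E - prob1 a.
Definition mcount : R := \sum_(a in A) prob1 a.
Definition ccount (E : {set T}) : R := \sum_(a in A) cind a E.
Definition touches (D : {set T}) (a : U) : bool := S a :&: D != set0.
Definition cnear (D E : {set T}) : R := \sum_(c in A | touches D c) cind c E.
Definition absind (a : U) (E : {set T}) : R := ind (S a) E + prob1 a.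
Definition absnear (D E : {set T}) : R := \sum_(c in A | touches D c) absind c E.
(** A nonnegative majorant of the sum of |I'_a Y_a| over all copies [a]. *)
Definition pairsum (E : {set T}) : R := \sum_(a in A) absind a E * absnear (S a) E.
Definition joint (l : seq U) : {set T} := \bigcup_(a <- l) S a.
Definition wprod (l : seq U) (E : {set T}) : R := \prod_(a <- l) absind a E.

Let p0 : 0 <= p. Proof. by case/andP: hp. Qed.
Implicit Types (D E : {set T}) (a c : U).
Let p1 : p <= 1. Proof. by case/andP: hp. Qed.

Lemma expr_anti i j : (i <= j)%N -> p ^+ j <= p ^+ i.
Proof. by move=> ij; apply: ler_wiXn2l. Qed.

Lemma prob1_ge0 a : 0 <= prob1 a. Proof. exact: exprn_ge0. Qed.
Lemma prob1_le1 a : prob1 a <= 1. Proof. exact: exprn_ile1. Qed.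
Lemma ind_ge0 D E : 0 <= ind D E. Proof. exact: ler0n. Qed.
Lemma ind_le1 D E : ind D E <= 1. Proof. by rewrite /ind; case: (_ \subset _). Qed.
Lemma absind_ge0 a E : 0 <= absind a E.
Proof. by rewrite addr_ge0 ?ind_ge0 ?prob1_ge0. Qed.
Lemma absnear_ge0 D E : 0 <= absnear D E.
Proof. by apply: sumr_ge0 => c _; apply: absind_ge0. Qed.
Lemma pairsum_ge0 E : 0 <= pairsum E.
Proof. by apply: sumr_ge0 => c _; rewrite mulr_ge0 ?absind_ge0 ?absnear_ge0. Qed.
Lemma mcount_ge0 : 0 <= mcount.
Proof. by apply: sumr_ge0 => c _; apply: prob1_ge0. Qed.

Lemma cind_le a E : `|cind a E| <= absind a E.
Proof.
rewrite /cind /absind ler_norml; have := ind_ge0 (S a) E; have := prob1_ge0 a.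
by move=> *; apply/andP; split; lra.
Qed.

Lemma cind_le1 a E : `|cind a E| <= 1.
Proof.
rewrite /cind ler_norml; have := ind_ge0 (S a) E; have := ind_le1 (S a) E.
by have := prob1_ge0 a; have := prob1_le1 a; move=> *; apply/andP; split; lra.
Qed.

Lemma cnear_le D E : `|cnear D E| <= absnear D E.
Proof. by apply: le_trans (ler_norm_sum _ _ _) _; apply: ler_sum => c _; apply: cind_le. Qed.

Lemma indI (D E X : {set T}) : D \subset X -> ind D E = ind D (E :&: X).
Proof. by move=> sDX; rewrite /ind subsetI sDX andbT. Qed.

Lemma indD (D E X : {set T}) : D :&: X = set0 -> ind D E = ind D (E :\: X).
Proof. by move/eqP; rewrite setI_eq0 => dDX; rewrite /ind subsetD dDX andbT. Qed.

Lemma cindI a E (X : {set T}) : S a \subset X -> cind a E = cind a (E :&: X).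
Proof. by move=> sX; rewrite /cind (indI E sX). Qed.

Lemma ex_ind D : D \subset N -> Ex (ind D) = p ^+ #|D|.
Proof. exact: rsexpect_contains. Qed.

Lemma ex_cind a : a \in A -> Ex (cind a) = 0.
Proof. by move=> aA; rewrite rsexpectB ex_ind ?hS // rsexpect_cst subrr. Qed.

Lemma ex_absind a : a \in A -> Ex (absind a) = prob1 a + prob1 a.
Proof. by move=> aA; rewrite rsexpectD ex_ind ?hS // rsexpect_cst. Qed.

Lemma ccount_subE D E :
  ccount E - cnear D E = \sum_(c in A | ~~ touches D c) cind c E.
Proof. by rewrite /ccount (bigID (touches D)) /= /cnear [X in X - _]addrC addrK. Qed.

(** Removing from X' all copies that meet [D] leaves only copies disjoint from [D], hence a variable
    independent of everything determined inside [D]. *)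
Lemma decouple D (F : R -> R) (g : {set T} -> R) :
  (forall E, g E = g (E :&: D)) ->
  Ex (fun E => g E * F (ccount E - cnear D E)) =
  Ex g * Ex (fun E => F (ccount E - cnear D E)).
Proof.
move=> gD; apply: (@rsexpect_indep _ _ _ _ D) => E _; first exact: gD.
rewrite !ccount_subE; congr F; apply: eq_bigr => c /andP[_].
by rewrite negbK => /eqP cD; rewrite /cind (indD E cD).
Qed.

Lemma joint_cons a l : joint (a :: l) = S a :|: joint l.
Proof. exact: big_cons. Qed.

Lemma joint_seq1 a : joint [:: a] = S a.
Proof. by rewrite /joint big_seq1. Qed.

Lemma sub_joint a l : a \in l -> S a \subset joint l.
Proof. by move=> al; rewrite /joint (big_rem a) //= subsetUl. Qed.

(** The extra set [D] makes the induction work. In the factor of [a], the indicator enlarges [D] by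
    [S a], and the constant [p ^+ #|S a|] costs at least as much as the edges that [S a] adds, since
    [p <= 1]. The two cases give the factor 2. *)
Lemma ex_wprod_ind (l : seq U) D : all (mem A) l -> D \subset N ->
  Ex (fun E => wprod l E * ind D E) <= 2 ^+ size l * p ^+ #|D :|: joint l|.
Proof.
elim: l D => [|a l IH] D /=.
  move=> _ sDN; rewrite expr0 mul1r /joint big_nil setU0 -ex_ind //.
  by apply: le_rsexpect => // E _; rewrite /wprod big_nil mul1r.
case/andP=> aA lA sDN; rewrite (@eq_rsexpect _ _ _ _ _ (fun E =>
  wprod l E * ind (D :|: S a) E + prob1 a * (wprod l E * ind D E))); last first.
  move=> E _; rewrite /wprod big_cons /absind.
  rewrite (_ : ind (D :|: S a) E = ind D E * ind (S a) E); last first.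
    by rewrite /ind subUset -natrM mulnb.
  ring.
rewrite rsexpectD rsexpectZ joint_cons.
have h1 := IH _ lA (_ : D :|: S a \subset N).
rewrite subUset sDN (hS aA) in h1; have {}h1 := h1 isT.
have h2 := ler_wpM2l (prob1_ge0 a) (IH _ lA sDN).
apply: le_trans (lerD h1 h2) _; rewrite exprS -setUA.
have h3 : prob1 a * p ^+ #|D :|: joint l| <= p ^+ #|D :|: (S a :|: joint l)|.
  rewrite -exprD; apply: expr_anti; rewrite setUCA.
  by rewrite (leq_trans _ (leq_card_setU _ _)).
have h4 : 0 <= 2 ^+ size l :> R by rewrite exprn_ge0.
by have := ler_wpM2l h4 h3; lra.
Qed.

Lemma ex_wprod (l : seq U) : all (mem A) l ->
  Ex (wprod l) <= 2 ^+ size l * p ^+ #|joint l|.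
Proof.
move=> lA; rewrite -[joint l]set0U; apply: le_trans (ex_wprod_ind lA (sub0set _)).
by apply: le_rsexpect => // E _; rewrite /ind sub0set mulr1.
Qed.

(** Given the edges of at most [K] copies, [b] bounds the conditional expected number of copies
    touching them. For extensions it will be a constant times mu / Phi, the constant depending on
    [K]. *)
Variables (K : nat) (b : R).
Hypothesis hb : forall l : seq U, (size l <= K)%N -> all (mem A) l ->
  \sum_(c in A | touches (joint l) c) p ^+ #|S c :\: joint l| <= b.

Lemma b_ge0 : 0 <= b.
Proof.
by apply: le_trans (hb (leq0n K : (size [::] <= K)%N) isT); apply: sumr_ge0 => *;
   apply: exprn_ge0.
Qed.

Lemma expr_joint_cons c l :
  p ^+ #|joint (c :: l)| = p ^+ #|joint l| * p ^+ #|S c :\: joint l|.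
Proof.
rewrite -exprD joint_cons; congr (_ ^+ _).
rewrite -(cardsID (joint l) (S c :|: joint l)) setIUl setIid (setUidPr (subsetIr _ _)).
by rewrite setDUl setDv setU0.
Qed.

Lemma sum_joint_near (l : seq U) D : (size l <= K)%N -> all (mem A) l ->
  D \subset joint l ->
  \sum_(c in A | touches D c) p ^+ #|joint (c :: l)| <= p ^+ #|joint l| * b.
Proof.
move=> sl lA sD.
apply: le_trans (ler_wpM2l (exprn_ge0 _ p0) (hb sl lA)); rewrite mulr_sumr.
rewrite [leRHS](bigID (touches D)) /= ler_wpDr //.
  by apply: sumr_ge0 => *; rewrite mulr_ge0 ?exprn_ge0.
rewrite le_eqVlt; apply/orP; left; apply/eqP; apply: eq_big => c.
  case cA : (c \in A) => //=; case mc: (touches D c); rewrite ?andbF // andbT.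
  symmetry; apply: contraNneq (mc) => h.
  by rewrite -subset0 -h setIS.
by move=> _; rewrite expr_joint_cons.
Qed.

(** A new copy either avoids the edges of [l], with total weight at most [mcount], or touches them,
    with total weight at most [b]. *)
Lemma sum_joint (l : seq U) : (size l <= K)%N -> all (mem A) l ->
  \sum_(c in A) p ^+ #|joint (c :: l)| <= p ^+ #|joint l| * (mcount + b).
Proof.
move=> sl lA; rewrite (bigID (touches (joint l))) /= mulrDr addrC.
apply: lerD; last exact: sum_joint_near.
rewrite /mcount mulr_sumr [leRHS](bigID (touches (joint l))) /= ler_wpDl //.
  by apply: sumr_ge0 => *; rewrite mulr_ge0 ?exprn_ge0.
apply: ler_sum => c /andP[_]; rewrite negbK => /eqP m0.
by rewrite expr_joint_cons (_ : S c :\: joint l = S c) // -[RHS](setID _ (joint l)) m0 set0U.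
Qed.

(** Peel off one factor of the power at a time and move its copy into [l]. As it touches the joint
    edge set, summing over it costs a factor [b]. *)
Lemma ex_wprod_absnear (l : seq U) D j : (size l + j <= K)%N -> all (mem A) l ->
  D \subset joint l ->
  Ex (fun E => wprod l E * absnear D E ^+ j) <=
  2 ^+ (size l + j) * b ^+ j * p ^+ #|joint l|.
Proof.
elim: j l => [|j IH] l sl lA sD.
  rewrite addn0 expr0 mulr1; apply: le_trans (ex_wprod lA).
  by apply: le_rsexpect => // E _; rewrite expr0 mulr1.
rewrite (@eq_rsexpect _ _ _ _ _ (fun E => \sum_(c in A | touches D c)
   wprod (c :: l) E * absnear D E ^+ j)); last first.
  move=> E _; rewrite exprS mulrA {1}/absnear mulr_sumr mulr_suml.
  by apply: eq_bigr => c _; rewrite /wprod big_cons; ring.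
rewrite rsexpect_sum.
apply: (@le_trans _ _ (\sum_(c in A | touches D c)
   2 ^+ (size l + j.+1) * b ^+ j * p ^+ #|joint (c :: l)|)).
  apply: ler_sum => c /andP[cA mc]; rewrite addnS -addSn; apply: IH => /=.
  - by rewrite addSn -addnS.
  - by rewrite cA.
  - by rewrite joint_cons (subset_trans sD) ?subsetUr.
rewrite -mulr_sumr.
rewrite (_ : _ * b ^+ j.+1 * _ =
  2 ^+ (size l + j.+1) * b ^+ j * (p ^+ #|joint l| * b)); last first.
  by rewrite exprSr; ring.
rewrite ler_wpM2l ?mulr_ge0 ?exprn_ge0 ?b_ge0 //; apply: sum_joint_near => //.
by apply: leq_trans sl; apply: leq_addr.
Qed.

(** Each factor [pairsum] moves two copies into [l]: an arbitrary [a], costing [mcount + b], and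
    then a neighbour of [a], costing [b]. *)
Lemma ex_wprod_pairsum (l : seq U) k : (size l + k.*2 <= K)%N -> all (mem A) l ->
  Ex (fun E => wprod l E * pairsum E ^+ k) <=
  2 ^+ (size l + k.*2) * ((mcount + b) * b) ^+ k * p ^+ #|joint l|.
Proof.
have b0 := b_ge0; have m0 := mcount_ge0.
elim: k l => [|k IH] l sl lA.
  rewrite addn0 expr0 mulr1; apply: le_trans (ex_wprod lA).
  by apply: le_rsexpect => // E _; rewrite expr0 mulr1.
rewrite (@eq_rsexpect _ _ _ _ _ (fun E => \sum_(a in A) \sum_(c in A | touches (S a) c)
   wprod (c :: a :: l) E * pairsum E ^+ k)); last first.
  move=> E _; rewrite exprS mulrA {1}/pairsum mulr_sumr mulr_suml.
  apply: eq_bigr => a _; rewrite {1}/absnear !mulr_sumr mulr_suml.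
  by apply: eq_bigr => c _; rewrite /wprod !big_cons; ring.
rewrite rsexpect_sum.
set C := 2 ^+ (size l + k.+1.*2) * ((mcount + b) * b) ^+ k.
have C0 : 0 <= C by rewrite mulr_ge0 ?exprn_ge0 // mulr_ge0 // addr_ge0.
have sl' : (size l <= K)%N by apply: leq_trans sl; apply: leq_addr.
apply: (@le_trans _ _ (\sum_(a in A) C * (p ^+ #|joint (a :: l)| * b))); last first.
  rewrite -mulr_sumr -mulr_suml.
  apply: le_trans (ler_wpM2l C0 (ler_wpM2r b0 (sum_joint sl' lA))) _.
  by rewrite /C [in leRHS]exprSr le_eqVlt; apply/orP; left; apply/eqP; ring.
apply: ler_sum => a aA; rewrite rsexpect_sum.
apply: (@le_trans _ _ (\sum_(c in A | touches (S a) c) C * p ^+ #|joint [:: c, a & l]|)).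
  apply: ler_sum => c /andP[cA _]; rewrite /C doubleS !addnS -!addSn; apply: IH => /=.
    by rewrite !addSn -!addnS -doubleS.
  by rewrite cA aA.
rewrite -mulr_sumr ler_wpM2l //; apply: sum_joint_near => //=.
- by apply: leq_trans sl; rewrite doubleS !addnS ltnS -addnS leq_addr.
- by rewrite aA.
- by rewrite joint_cons subsetUl.
Qed.

End Counts.

(** * Central moments *)

(** Here [c] is the constant of [exprB_le] at the exponent 2k + 1, [(2 * c) ^+ k] comes from Young's
    inequality, the power of 4 from the two copies per factor, and the leading 2 from absorbing half
    of the moment. *)
Definition moment_const (R : realFieldType) (k : nat) : R :=
  let c := (k.*2.+1 * 2 ^ k.*2)%:R in 2 * (c * (2 * c) ^+ k + c) * 4 ^+ k.+1.

Lemma exprD_le_max (R : realFieldType) (x y : R) n : 0 <= x -> 0 <= y ->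
  (x + y) ^+ n <= 2 ^+ n * (x ^+ n + y ^+ n).
Proof.
move=> x0 y0; have [xy|/ltW yx] := leP x y.
  apply: (@le_trans _ _ ((2 * y) ^+ n)); first by apply: lerXn2r; rewrite ?nnegrE; lra.
  by rewrite exprMn ler_wpM2l ?exprn_ge0 // lerDr exprn_ge0.
apply: (@le_trans _ _ ((2 * x) ^+ n)); first by apply: lerXn2r; rewrite ?nnegrE; lra.
by rewrite exprMn ler_wpM2l ?exprn_ge0 // lerDl exprn_ge0.
Qed.

(** Factor the difference of powers: it is [y] times a sum of [n.+1] products, each at most (|x| +
    |y|)^n. *)
Lemma exprB_le (R : realFieldType) (x y : R) n :
  `|x ^+ n.+1 - (x - y) ^+ n.+1| <=
  (n.+1 * 2 ^ n)%:R * (`|y| * `|x| ^+ n + `|y| ^+ n.+1).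
Proof.
rewrite subrXX opprB addrC subrK normrM.
have h i : (i < n.+1)%N -> `|x ^+ (n.+1.-1 - i) * (x - y) ^+ i| <=
    (`|x| + `|y|) ^+ n.
  rewrite ltnS => lin; rewrite normrM !normrX -{2}(subnK lin) exprD /=.
  apply: ler_pM; rewrite ?exprn_ge0 //.
    by apply: lerXn2r; rewrite ?nnegrE ?addr_ge0 // lerDl.
  by apply: lerXn2r; rewrite ?nnegrE ?addr_ge0 // ler_normB.
have h2 : `|\sum_(i < n.+1) x ^+ (n.+1.-1 - i) * (x - y) ^+ i| <=
    n.+1%:R * (2 ^+ n * (`|x| ^+ n + `|y| ^+ n)).
  apply: le_trans (ler_norm_sum _ _ _) _.
  apply: (@le_trans _ _ (\sum_(i < n.+1) (`|x| + `|y|) ^+ n)).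
    by apply: ler_sum => i _; apply: h.
  rewrite sumr_const card_ord -[leLHS]mulr_natl ler_wpM2l ?ler0n //.
  exact: exprD_le_max.
apply: le_trans (ler_wpM2l (normr_ge0 y) h2) _.
by rewrite natrM natrX exprS le_eqVlt; apply/orP; left; apply/eqP; ring.
Qed.

(** A form of Young's inequality: the first term wins if [2 * c * t <= x], the second otherwise. The
    scaling is such that [c] times the first term is half of [x ^+ k.+1]. *)
Lemma young_absorb (R : realFieldType) (t x c : R) k : 0 <= t -> 0 <= x -> 0 < c ->
  t * x ^+ k <= x ^+ k.+1 / (2 * c) + (2 * c) ^+ k * t ^+ k.+1.
Proof.
move=> t0 x0 c0; have c2 : 0 < 2 * c by lra.
have [h|/ltW h] := leP (2 * c * t) x.
  apply: ler_wpDr; first by rewrite mulr_ge0 ?exprn_ge0 // ltW.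
  by rewrite ler_pdivlMr // exprS mulrAC ler_wpM2r ?exprn_ge0 // mulrC.
apply: ler_wpDl; first by rewrite mulr_ge0 ?exprn_ge0 // invr_ge0 ltW.
rewrite exprS mulrCA -exprMn ler_wpM2l //.
by apply: lerXn2r; rewrite ?nnegrE ?mulr_ge0 // ltW.
Qed.

Section Moment.
Variables (R : realFieldType) (T U : finType) (N : {set T}) (p : R).
Hypothesis hp : 0 <= p <= 1.
Variables (A : {set U}) (S : U -> {set T}).
Hypothesis hS : forall a, a \in A -> S a \subset N.
Variables (K : nat) (b : R).
Hypothesis hb : forall l : seq U, (size l <= K)%N -> all (mem A) l ->
  \sum_(c in A | touches S (joint S l) c) p ^+ #|S c :\: joint S l| <= b.

Local Notation Ex := (rsexpect N p).
Local Notation X' := (ccount p A S).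
Local Notation mu := (mcount p A S).

Lemma cind_selfI a E : cind p S a E = cind p S a (E :&: S a).
Proof. exact: cindI. Qed.

(** The subtracted term has expectation 0, because I'_a is centred and independent of X' - Y_a. *)
Lemma ex_cind_decouple (F : R -> R) a : a \in A ->
  Ex (fun E => cind p S a E * F (X' E)) =
  Ex (fun E => cind p S a E * (F (X' E) - F (X' E - cnear p A S (S a) E))).
Proof.
move=> aA; under [RHS]eq_rsexpect do rewrite mulrBr.
rewrite rsexpectB (@decouple _ _ _ _ _ _ _ _ F _ (cind_selfI a)).
by rewrite (ex_cind _ hS aA) mul0r subr0.
Qed.

Lemma central_moment k : (k.+1.*2 <= K)%N ->
  Ex (fun E => X' E ^+ k.+1.*2) <= moment_const R k * ((mu + b) * b) ^+ k.+1.
Proof.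
move=> kK; have b0 := b_ge0 hp hb; have m0 := mcount_ge0 hp A S.
set M := Ex _; set B := (mu + b) * b.
have B0 : 0 <= B by rewrite mulr_ge0 // addr_ge0.
pose n := k.*2; pose c : R := (n.+1 * 2 ^ n)%:R.
have c0 : 0 < c by rewrite ltr0n muln_gt0 expn_gt0.
have absind0 a E := absind_ge0 hp S a E; have absnear0 D E := absnear_ge0 hp A S D E.
(* Write X'^(2k+2) as the sum of I'_a X'^(2k+1), decouple each term, and bound the resulting
   difference of powers in terms of |Y_a|. *)
have M_le : M <= c * Ex (fun E => pairsum p A S E * (X' E ^+ 2) ^+ k) +
    c * \sum_(a in A) Ex (fun E => absind p S a E * absnear p A S (S a) E ^+ n.+1).
  rewrite /M (@eq_rsexpect _ _ _ _ _ (fun E => \sum_(a in A)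
     cind p S a E * X' E ^+ n.+1)); last first.
    by move=> E _; rewrite -mulr_suml -exprS.
  rewrite -!rsexpectZ -rsexpect_sum -rsexpectZ -rsexpectD rsexpect_sum.
  rewrite (eq_bigr _ (fun a aA => ex_cind_decouple (fun x => x ^+ n.+1) aA)) -rsexpect_sum.
  apply: le_rsexpect => // E _; rewrite [pairsum _ _ _ _]/pairsum.
  rewrite mulr_suml -mulrDr -big_split mulr_sumr /=; apply: ler_sum => a aA.
  apply: le_trans (ler_norm _) _; rewrite normrM.
  apply: le_trans (ler_pM _ _ (cind_le hp S a E) (exprB_le _ _ _)) _ => //.
  rewrite mulrCA; apply: ler_wpM2l; first exact: ltW.
  rewrite -mulrA -mulrDr; apply: ler_wpM2l => //.
  have hn := cnear_le hp A S (S a) E.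
  apply: lerD; last by apply: lerXn2r; rewrite ?nnegrE.
  rewrite (_ : `|X' E| ^+ n = (X' E ^+ 2) ^+ k); last first.
    by rewrite -exprM mul2n -normrX ger0_norm // exprn_even_ge0 // odd_double.
  by rewrite ler_wpM2r // exprn_ge0 // sqr_ge0.
(* Young's inequality with x = X'^2 and t = [pairsum] returns a multiple of [M] that is small enough
   to be absorbed on the left. *)
have first_le : Ex (fun E => pairsum p A S E * (X' E ^+ 2) ^+ k) <=
    M / (2 * c) + (2 * c) ^+ k * (4 ^+ k.+1 * B ^+ k.+1).
  have h := ex_wprod_pairsum hp hS hb (l := [::]) kK isT.
  rewrite /= add0n -mul2n exprM /joint big_nil cards0 expr0 mulr1 in h.
  rewrite (_ : 2 ^+ 2 = 4 :> R) in h; last by ring.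
  have c2 : 0 <= (2 * c) ^+ k by rewrite exprn_ge0 // mulr_ge0 // ltW.
  apply: le_trans (lerD (lexx _) (ler_wpM2l c2 h)).
  rewrite /M -rsexpectZr -rsexpectZ -rsexpectD; apply: le_rsexpect => // E _.
  rewrite /wprod big_nil mul1r -mul2n exprM.
  by apply: young_absorb; rewrite ?sqr_ge0 ?pairsum_ge0.
have second_le : \sum_(a in A) Ex (fun E => absind p S a E * absnear p A S (S a) E ^+ n.+1) <=
    4 ^+ k.+1 * B ^+ k.+1.
  apply: (@le_trans _ _ (\sum_(a in A) 4 ^+ k.+1 * b ^+ n.+1 * prob1 p S a)).
    apply: ler_sum => a aA.
    have sD : S a \subset joint S [:: a] by rewrite joint_seq1.
    have h := @ex_wprod_absnear _ _ _ _ _ hp _ _ hS _ _ hb [:: a] (S a) n.+1.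
    rewrite /= aA joint_seq1 subxx in h; have {}h := h kK isT isT.
    rewrite (_ : 2 ^+ (1 + n.+1) = 4 ^+ k.+1) in h; last first.
      by rewrite (_ : 4 = 2 ^+ 2 :> R) -?exprM ?mul2n //; ring.
    apply: le_trans h; apply: le_rsexpect => // E _.
    by rewrite /wprod big_seq1.
  rewrite -mulr_sumr -/mu -mulrA ler_wpM2l ?exprn_ge0 //.
  (* Since n = 2k, this leaves the comparison of mu b^k with (mu + b)^(k+1). *)
  rewrite (_ : b ^+ n.+1 * mu = mu * b ^+ k * b ^+ k.+1); last first.
    by rewrite /n -addnn -addnS exprD; ring.
  rewrite /B exprMn ler_wpM2r ?exprn_ge0 // exprS ler_pM ?exprn_ge0 ?lerDl //.
  by apply: lerXn2r; rewrite ?nnegrE ?lerDr ?addr_ge0.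
have h1 := ler_wpM2l (ltW c0) first_le.
have h2 := ler_wpM2l (ltW c0) second_le.
have -> : moment_const R k * B ^+ k.+1 =
    2 * (c * ((2 * c) ^+ k * (4 ^+ k.+1 * B ^+ k.+1)) + c * (4 ^+ k.+1 * B ^+ k.+1)).
  by rewrite /moment_const -/n -/c; ring.
have e : c * (M / (2 * c) + (2 * c) ^+ k * (4 ^+ k.+1 * B ^+ k.+1)) =
    M / 2 + c * ((2 * c) ^+ k * (4 ^+ k.+1 * B ^+ k.+1)).
  have : c != 0 by rewrite gt_eqF.
  by move: (c) => y y0; field.
rewrite e in h1; lra.
Qed.


End Moment.

(** * Anti-concentration *)

Section SoftSign.
Variable R : realFieldType.
Implicit Types a b x y z : R.

(** The function h of the overview; [softsign'] is its derivative. Both are rational on each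
    half-line, so all estimates reduce to polynomial inequalities over an ordered field. *)
Definition softsign z : R := z / (1 + `|z|).
Definition softsign' z : R := (1 + `|z|) ^- 2.

Lemma softsign_le1 z : `|softsign z| <= 1.
Proof.
have z0 := normr_ge0 z.
rewrite normrM normfV (ger0_norm (_ : 0 <= 1 + `|z|)) ?addr_ge0 //.
by rewrite ler_pdivrMr ?mul1r; lra.
Qed.

Lemma softsign'_ge0 z : 0 <= softsign' z.
Proof. by rewrite invr_ge0 sqr_ge0. Qed.

Lemma softsign'_ge z : `|z| <= 1 -> 1 / 4 <= softsign' z.
Proof.
have z0 := normr_ge0 z; move=> z1; rewrite /softsign' div1r lef_pV2 ?posrE; [by nra|by lra|].
by rewrite exprn_gt0 //; lra.
Qed.

Lemma softsign'_lip x y : `|softsign' x - softsign' y| <= 2 * `|x - y|.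
Proof.
apply: le_trans (_ : _ <= 2 * `| `|x| - `|y| |) _; last first.
  by rewrite ler_wpM2l // ler_dist_dist.
rewrite /softsign'; move: (`|x|) (`|y|) (normr_ge0 x) (normr_ge0 y) => a b a0 b0.
have -> : (1 + a) ^- 2 - (1 + b) ^- 2 =
    (b - a) * ((2 + a + b) / ((1 + a) ^+ 2 * (1 + b) ^+ 2)).
  by field; apply/andP; split; rewrite gt_eqF //; lra.
rewrite normrM distrC mulrC ler_wpM2r //.
have D0 : 0 < (1 + a) ^+ 2 * (1 + b) ^+ 2 by rewrite mulr_gt0 // exprn_gt0 //; lra.
rewrite ger0_norm; last by rewrite divr_ge0 // ?ltW //; lra.
rewrite ler_pdivrMr //.
have ab := mulr_ge0 a0 b0.
have h1 : 1 + a <= (1 + a) ^+ 2 by nra.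
have h2 : 1 + b <= (1 + b) ^+ 2 by nra.
have : (1 + a) * (1 + b) <= (1 + a) ^+ 2 * (1 + b) ^+ 2 by apply: ler_pM => //; lra.
nra.
Qed.

(** The derivative is 2-Lipschitz, which is why the quadratic remainder has constant 1. The proof is
    algebraic, split by the signs of [a] and [b]. *)
Lemma softsign_taylor a b :
  `|softsign a - softsign b - softsign' b * (a - b)| <= (a - b) ^+ 2.
Proof.
(* [softsign] is odd and [softsign'] is even. *)
wlog b0 : a b / 0 <= b => [hw|].
  have [/hw//|/ltW bn] := leP 0 b.
  have := hw (- a) (- b); rewrite oppr_ge0 => /(_ bn).
  rewrite /softsign /softsign' !normrN.
  have -> : (- a - - b) ^+ 2 = (a - b) ^+ 2 by ring.
  move: (1 + `|a|)^-1 ((1 + `|b|)^-1) ((1 + `|b|) ^- 2) => u v w.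
  by have -> : - a * u - - b * v - w * (- a - - b) = - (a * u - b * v - w * (a - b));
    [ring|rewrite normrN].
rewrite /softsign /softsign' (ger0_norm b0).
have [a0|an] := leP 0 a.
  rewrite (ger0_norm a0).
  have -> : a / (1 + a) - b / (1 + b) - (1 + b) ^- 2 * (a - b) =
      - ((a - b) ^+ 2 / ((1 + a) * (1 + b) ^+ 2)).
    by field; apply/andP; split; rewrite gt_eqF //; lra.
  have D1 : 1 <= (1 + a) * (1 + b) ^+ 2.
    by rewrite -[1]mulr1 ler_pM // ?exprn_ege1 //; lra.
  have D0 : 0 < (1 + a) * (1 + b) ^+ 2 by lra.
  rewrite normrN ger0_norm; last by rewrite divr_ge0 ?sqr_ge0 // ltW.
  by rewrite ler_pdivrMr // ler_peMr // sqr_ge0.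
rewrite (ltr0_norm an).
have [c [c0 ->]] : exists c, 0 < c /\ a = - c by exists (- a); rewrite opprK oppr_gt0.
rewrite opprK.
have D0 : 0 < (1 + c) * (1 + b) ^+ 2 by rewrite mulr_gt0 // ?exprn_gt0 //; lra.
have -> : - c / (1 + c) - b / (1 + b) - (1 + b) ^- 2 * (- c - b) =
    (c ^+ 2 - 2 * b * c - 2 * b ^+ 2 * c - b ^+ 2) / ((1 + c) * (1 + b) ^+ 2).
  by field; apply/andP; split; rewrite gt_eqF //; lra.
rewrite normrM normfV (gtr0_norm D0) ler_pdivrMr //.
have bc := mulr_ge0 b0 (ltW c0); have bbc := mulr_ge0 b0 bc.
have b2 := sqr_ge0 b; have c2 := sqr_ge0 c.
(* The lower bound 1 + 2b for the denominator is already enough: the differences left to check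
   expand into monomials with nonnegative coefficients. *)
have h : (- c - b) ^+ 2 * (1 + 2 * b) <= (- c - b) ^+ 2 * ((1 + c) * (1 + b) ^+ 2).
  apply: ler_wpM2l; first exact: sqr_ge0.
  have : (1 + b) ^+ 2 <= (1 + c) * (1 + b) ^+ 2 by rewrite ler_peMl ?sqr_ge0 //; lra.
  nra.
apply: le_trans h.
have b3 := mulr_ge0 b0 b2; have bc2 := mulr_ge0 b0 c2.
rewrite ler_norml; apply/andP; split; rewrite -subr_ge0.
  rewrite (_ : _ - _ = 2 * c ^+ 2 + 2 * (b * b ^+ 2) + 2 * (b * (b * c)) + 2 * (b * c ^+ 2)).
    lra.
  ring.
rewrite (_ : _ - _ = 2 * b ^+ 2 + 4 * (b * c) + 2 * (b * b ^+ 2) + 6 * (b * (b * c))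
   + 2 * (b * c ^+ 2)).
  lra.
ring.
Qed.

End SoftSign.

(** * Stein's identity and small-ball probabilities *)

Definition stein_const (r : nat) : nat := (16 + 2 * r * 8 ^ r)%N.

Section Stein.
Variables (R : realFieldType) (T U : finType) (N : {set T}) (p : R).
Hypothesis hp : 0 <= p <= 1.
Variables (A : {set U}) (S : U -> {set T}).
Hypothesis hS : forall a, a \in A -> S a \subset N.

Local Notation Ex := (rsexpect N p).
Local Notation X' := (ccount p A S).
Local Notation mu := (mcount p A S).
Local Notation I' := (cind p S).

Let p0 : 0 <= p. Proof. by case/andP: hp. Qed.
Let p1 : p <= 1. Proof. by case/andP: hp. Qed.

(** The covariance of the indicators of [a] and [c]. *)
Definition kappa a c : R := p ^+ #|S a :|: S c| - prob1 p S a * prob1 p S c.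

Lemma ex_cind2 a c : a \in A -> c \in A -> Ex (fun E => I' a E * I' c E) = kappa a c.
Proof.
move=> aA cA; rewrite (@eq_rsexpect _ _ _ _ _ (fun E => ind R (S a :|: S c) E
   - prob1 p S a * I' c E - prob1 p S c * ind R (S a) E)); last first.
  move=> E _; rewrite /cind (_ : ind R (S a :|: S c) E = ind R (S a) E * ind R (S c) E).
    ring.
  by rewrite /ind subUset -natrM mulnb.
rewrite !rsexpectB !rsexpectZ (ex_cind _ hS cA) !ex_ind ?subUset ?hS // /kappa /prob1; ring.
Qed.

Lemma kappaE a c : kappa a c = p ^+ #|S a :|: S c| * (1 - p ^+ #|S a :&: S c|).
Proof.
rewrite /kappa /prob1 -exprD mulrBr mulr1 -exprD; congr (_ - p ^+ _).
by rewrite cardsU subnK // (leq_trans (subset_leq_card (subsetIl _ _))) // leq_addr.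
Qed.

Lemma kappa_ge0 a c : 0 <= kappa a c.
Proof. by rewrite kappaE mulr_ge0 ?exprn_ge0 // subr_ge0 exprn_ile1. Qed.

Lemma kappa_ge a c : touches S (S a) c -> (1 - p) * p ^+ #|S a :|: S c| <= kappa a c.
Proof.
rewrite /touches setIC -card_gt0 kappaE mulrC => h.
by rewrite ler_wpM2l ?exprn_ge0 // lerB // -[leRHS]expr1 expr_anti.
Qed.

Lemma kappa_far a c : ~~ touches S (S a) c -> kappa a c = 0.
Proof. by rewrite negbK setIC kappaE => /eqP->; rewrite cards0 expr0 subrr mulr0. Qed.

Lemma varE : Ex (fun E => X' E ^+ 2) = \sum_(a in A) \sum_(c in A | touches S (S a) c) kappa a c.
Proof.
rewrite (@eq_rsexpect _ _ _ _ _ (fun E => \sum_(a in A) \sum_(c in A) I' a E * I' c E)); last first.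
  by move=> E _; rewrite expr2 {1}/ccount mulr_suml; apply: eq_bigr => a _; rewrite mulr_sumr.
rewrite rsexpect_sum; apply: eq_bigr => a aA; rewrite rsexpect_sum (bigID (touches S (S a))) /=.
rewrite [X in _ + X]big1 ?addr0.
  by apply: eq_bigr => c /andP[cA _]; rewrite ex_cind2.
by move=> c /andP[cA nm]; rewrite ex_cind2 // kappa_far.
Qed.

Lemma onem_expr_le r : 1 - p ^+ r <= r%:R * (1 - p).
Proof.
elim: r => [|r IH]; first by rewrite expr0 subrr mul0r.
have h : p ^+ r * (1 - p) <= 1 - p by rewrite ler_piMl ?subr_ge0 // exprn_ile1.
by rewrite exprSr -natr1; lra.
Qed.

Variable (r : nat).
Hypothesis hr : forall a, a \in A -> (#|S a| <= r)%N.

Lemma ex_norm_cind a : a \in A -> Ex (fun E => `|I' a E|) <= 2 * r%:R * (1 - p).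
Proof.
move=> aA; have q0 := prob1_ge0 hp S a; have q1 := prob1_le1 hp S a.
apply: (@le_trans _ _ (2 * prob1 p S a * (1 - prob1 p S a))).
  rewrite (@eq_rsexpect _ _ _ _ _ (fun E =>
    (1 - 2 * prob1 p S a) * ind R (S a) E + prob1 p S a)); last first.
    move=> E _; rewrite /cind /ind; case: (S a \subset E) => /=.
      by rewrite ger0_norm; lra.
    by rewrite ler0_norm; lra.
  rewrite rsexpectD rsexpectZ rsexpect_cst ex_ind ?hS // -/(prob1 p S a).
  by rewrite le_eqVlt; apply/orP; left; apply/eqP; ring.
have h1 := onem_expr_le #|S a|; rewrite -/(prob1 p S a) in h1.
have h2 : #|S a|%:R * (1 - p) <= r%:R * (1 - p).
  by rewrite ler_wpM2r ?subr_ge0 // ler_nat hr.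
by nra.
Qed.

(** This merges a bound that is good for small [p] with one that is good near 1. If p < 1/2 then 8
    <= 16 (1 - p); otherwise p^n >= 8^(-r), because n <= 3r. *)
Lemma le_stein_const (y : R) n : (n <= 3 * r)%N -> y <= 8 * p ^+ n ->
  y <= 2 * r%:R * (1 - p) -> y <= (stein_const r)%:R * (1 - p) * p ^+ n.
Proof.
move=> nr y1 y2; rewrite /stein_const natrD mulrDl mulrDl !natrM natrX.
have pn := exprn_ge0 n p0; have q0 : 0 <= 1 - p by rewrite subr_ge0.
have r0 : 0 <= r%:R :> R by rewrite ler0n.
have [ph|/ltW ph] := leP p (1 / 2).
  apply: ler_wpDr; last by nra.
  by rewrite !mulr_ge0 ?exprn_ge0.
apply: ler_wpDl; first by rewrite !mulr_ge0.
apply: le_trans y2 _.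
have h : 1 <= 8 ^+ r * p ^+ n.
  have h0 : 1 <= 8 ^+ r * p ^+ (3 * r).
    by rewrite exprM -exprMn exprn_ege1 //; nra.
  apply: le_trans h0 _; rewrite ler_wpM2l ?exprn_ge0 //; exact: expr_anti.
have h2 : 0 <= 2 * r%:R * (1 - p) by rewrite !mulr_ge0.
by have := ler_wpM2l h2 h; lra.
Qed.

Lemma card_joint3 a c e : a \in A -> c \in A -> e \in A ->
  (#|joint S [:: e; c; a]| <= 3 * r)%N.
Proof.
move=> aA cA eA; rewrite !joint_cons /joint big_nil setU0.
apply: leq_trans (leq_card_setU _ _) _; rewrite !mulSn mul0n addn0.
apply: leq_add; first exact: hr.
by apply: leq_trans (leq_card_setU _ _) _; apply: leq_add; apply: hr.
Qed.

(** A common bound for the two third-order error terms of Stein's identity. The factor [1 - p]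
    matches the one in the variance and keeps the estimate sharp when [p] is near 1. *)
Definition wt a c e : R := (stein_const r)%:R * (1 - p) * p ^+ #|joint S [:: e; c; a]|.

Lemma wt_ge0 a c e : 0 <= wt a c e.
Proof. by rewrite !mulr_ge0 ?exprn_ge0 ?ler0n ?subr_ge0. Qed.

(** For small [p] multiply the three majorants [absind]; near 1 bound two factors by 1 and use that
    E|I'_a| = O(1 - p). *)
Lemma ex_triple a c e : a \in A -> c \in A -> e \in A ->
  Ex (fun E => `|I' a E * I' c E * I' e E|) <= wt a c e.
Proof.
move=> aA cA eA; apply: le_stein_const; first exact: card_joint3.
  have h := @ex_wprod _ _ _ _ _ hp _ _ hS [:: e; c; a].
  rewrite /= aA cA eA in h; have {}h := h isT.
  rewrite (_ : 2 ^+ 3 = 8 :> R) in h; last by ring.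
  apply: le_trans h; apply: le_rsexpect => // E _.
  rewrite /wprod !big_cons big_nil mulr1 !normrM [leRHS]mulrC [_ * absind p S a E]mulrC.
  by rewrite !ler_pM ?mulr_ge0 ?cind_le.
apply: le_trans (ex_norm_cind aA); apply: le_rsexpect => // E _.
by rewrite -mulrA normrM ler_piMr // normrM mulr_ile1 // cind_le1.
Qed.

Lemma ex_pair_single a c e : a \in A -> c \in A -> e \in A ->
  kappa a c * Ex (fun E => `|I' e E|) <= wt a c e.
Proof.
move=> aA cA eA.
have e0 : 0 <= Ex (fun E => `|I' e E|) by apply: rsexpect_ge0.
have k0 := kappa_ge0 a c.
have k1 : kappa a c <= Ex (fun E => `|I' a E * I' c E|).
  by rewrite -ex_cind2 //; apply: le_rsexpect => // E _; apply: ler_norm.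
apply: le_stein_const; first exact: card_joint3.
  have hka : kappa a c <= p ^+ #|S a :|: S c|.
    by rewrite /kappa lerBlDr lerDl mulr_ge0 // prob1_ge0.
  have hee : Ex (fun E => `|I' e E|) <= 2 * p ^+ #|S e|.
    have -> : 2 * p ^+ #|S e| = Ex (absind p S e) by rewrite (ex_absind _ hS) // /prob1; ring.
    by apply: le_rsexpect => // E _; apply: cind_le.
  apply: le_trans (ler_pM k0 e0 hka hee) _.
  rewrite mulrCA -exprD.
  apply: (@le_trans _ _ (8 * p ^+ (#|S a :|: S c| + #|S e|))).
    by rewrite ler_wpM2r ?exprn_ge0 //; lra.
  rewrite ler_wpM2l //; apply: expr_anti => //.
  by rewrite !joint_cons /joint big_nil setU0 [S c :|: _]setUC addnC leq_card_setU.
apply: (@le_trans _ _ (kappa a c)).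
  rewrite ler_piMr // -[leRHS](rsexpect1 p N); apply: le_rsexpect => // E _.
  exact: cind_le1.
apply: le_trans k1 _; apply: le_trans (ex_norm_cind aA); apply: le_rsexpect => // E _.
by rewrite normrM ler_piMr // cind_le1.
Qed.

Variables (K : nat) (b : R).
Hypothesis hb : forall l : seq U, (size l <= K)%N -> all (mem A) l ->
  \sum_(c in A | touches S (joint S l) c) p ^+ #|S c :\: joint S l| <= b.
Hypothesis hK : (2 <= K)%N.

Definition wsum : R := \sum_(a in A) \sum_(c in A | touches S (S a) c)
  \sum_(e in A | touches S (joint S [:: c; a]) e) wt a c e.

Lemma wsum_le : wsum <= (stein_const r)%:R * (1 - p) * mu * b ^+ 2.
Proof.
have b0 := b_ge0 hp hb.
set C := (stein_const r)%:R * (1 - p).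
have C0 : 0 <= C by rewrite mulr_ge0 ?ler0n ?subr_ge0.
rewrite (_ : C * mu * b ^+ 2 = \sum_(a in A) C * (prob1 p S a * b * b)); last first.
  by rewrite -mulr_sumr -!mulr_suml /mcount; ring.
apply: ler_sum => a aA.
apply: (@le_trans _ _ (\sum_(c in A | touches S (S a) c) C * (p ^+ #|joint S [:: c; a]| * b))).
  apply: ler_sum => c /andP[cA _]; rewrite -mulr_sumr ler_wpM2l //.
  by apply: (sum_joint_near hp hb) => //=; rewrite ?cA ?aA.
rewrite -mulr_sumr -mulr_suml ler_wpM2l // ler_wpM2r //.
have h := @sum_joint_near _ _ _ _ hp _ _ _ _ hb [:: a] (S a).
by rewrite /= aA joint_seq1 subxx in h; apply: h => //; apply: leq_trans hK.
Qed.

(** Compute d E X' h(X'/d) by decoupling each copy. The main term is Var(X') E h'(X'/d); the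
    constant 5 is 1 from the Taylor remainder plus 4 from two applications of the Lipschitz bound
    for h'. *)
Lemma stein_softsign d : 0 < d ->
  Ex (fun E => X' E ^+ 2) * Ex (fun E => softsign' (X' E / d)) <=
  d * Ex (fun E => `|X' E|) + 5 * wsum / d.
Proof.
move=> d0; rewrite varE.
set G := Ex (fun E => softsign' _).
pose Y D E := cnear p A S D E.
have Yle D E : `|Y D E| <= \sum_(e in A | touches S D e) `|I' e E| by apply: ler_norm_sum.
have step1 : d * Ex (fun E => X' E * softsign (X' E / d)) <= d * Ex (fun E => `|X' E|).
  apply: (ler_wpM2l (ltW d0)); apply: le_rsexpect => // E _.
  by apply: le_trans (ler_norm _) _; rewrite normrM ler_piMr // softsign_le1.
apply: le_trans (_ : _ <= d * Ex (fun E => X' E * softsign (X' E / d)) + 5 * wsum / d) _;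
  last by rewrite lerD2r.
rewrite {step1} (@eq_rsexpect _ _ _ _ (fun E => X' E * _) (fun E => \sum_(a in A)
   I' a E * softsign (X' E / d))); last by move=> E _; rewrite mulr_suml.
rewrite rsexpect_sum [d * _]mulr_sumr [_ * G]mulr_suml /wsum.
rewrite (_ : 5 * _ / d = \sum_(a in A) 5 / d * (\sum_(c in A | touches S (S a) c)
  \sum_(e in A | touches S (joint S [:: c; a]) e) wt a c e)); last by rewrite -mulr_sumr mulrAC.
rewrite -big_split /=; apply: ler_sum => a aA.
rewrite (ex_cind_decouple p hS (fun x => softsign (x / d)) aA).
(* Taylor expansion at X'/d with increment -Y_a/d. The remainder |I'_a| Y_a^2 / d expands into
   triples a, c, e in which both c and e are neighbours of a. *)
have step2 : \sum_(c in A | touches S (S a) c) Ex (fun E => I' a E * I' c E * softsign' (X' E / d))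
    - d^-1 * (\sum_(c in A | touches S (S a) c)
       \sum_(e in A | touches S (joint S [:: c; a]) e) wt a c e) <=
    d * Ex (fun E => I' a E * (softsign (X' E / d) - softsign ((X' E - Y (S a) E) / d))).
  apply: le_trans (_ : _ <= d * Ex (fun E => I' a E * Y (S a) E * softsign' (X' E / d) / d
     - `|I' a E| * (Y (S a) E / d) ^+ 2)) _; last first.
    apply: (ler_wpM2l (ltW d0)); apply: le_rsexpect => // E _.
    have := softsign_taylor ((X' E - Y (S a) E) / d) (X' E / d).
    have -> : (X' E - Y (S a) E) / d - X' E / d = - (Y (S a) E / d).
      by field; rewrite gt_eqF.
    rewrite sqrrN; set u := softsign _; set v := softsign _; set w := softsign' _.
    set y := Y (S a) E / d => h.
    have -> : I' a E * Y (S a) E * w / d = I' a E * (w * y) by rewrite /y; ring.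
    have h2 : - (`|I' a E| * y ^+ 2) <= I' a E * ((v - u) - w * y).
      apply: le_trans (lerNnormlW (lexx _)); rewrite lerN2 normrM ler_wpM2l //.
      apply: le_trans h; rewrite -normrN le_eqVlt; apply/orP; left; apply/eqP.
      by congr `|_|; ring.
    by move: h2; rewrite mulrBr; lra.
  rewrite rsexpectB mulrBr rsexpectZr mulrCA divff ?gt_eqF // mulr1; apply: lerB.
    rewrite -rsexpect_sum le_eqVlt; apply/orP; left; apply/eqP.
    by apply: eq_rsexpect => E _; rewrite -mulr_suml -mulr_sumr.
  rewrite (@eq_rsexpect _ _ _ _ _ (fun E => d ^- 2 * (`|I' a E| * Y (S a) E ^+ 2))); last first.
    by move=> E _; field; rewrite gt_eqF.
  rewrite rsexpectZ mulrA (_ : d * d ^- 2 = d^-1); last by field; rewrite gt_eqF.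
  apply: ler_wpM2l; first by rewrite invr_ge0 ltW.
  apply: le_trans (_ : _ <= Ex (fun E => \sum_(c in A | touches S (S a) c)
     \sum_(e in A | touches S (S a) e) `|I' a E * I' c E * I' e E|)) _.
    apply: le_rsexpect => // E _; rewrite -real_normK ?num_real // expr2.
    under eq_bigr do [under eq_bigr do rewrite !normrM; rewrite -mulr_sumr].
    rewrite -mulr_suml -mulr_sumr -mulrA ler_wpM2l // ler_pM //; exact: Yle.
  rewrite rsexpect_sum; apply: ler_sum => c /andP[cA _]; rewrite rsexpect_sum.
  rewrite [leRHS](bigID (touches S (S a))) /=; apply: ler_wpDr.
    by apply: sumr_ge0 => e _; apply: wt_ge0.
  apply: le_trans (_ : _ <= \sum_(e in A | touches S (S a) e) wt a c e) _.
    by apply: ler_sum => e /andP[eA _]; apply: ex_triple.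
  rewrite le_eqVlt; apply/orP; left; apply/eqP; apply: eq_bigl => e.
  case eA : (e \in A) => //=; case me: (touches S (S a) e); rewrite ?andbF // andbT.
  symmetry; move: me; rewrite /touches; apply: contraNneq => h.
  by rewrite -subset0 -h setIS // sub_joint // !inE eqxx orbT.
(* Replace X' inside h' by X' - Y_D, where D is the union of the edges of a and c, factor out the
   covariance by independence, and restore X'. Each replacement costs 2/d times the sum [W] of the
   triple weights. *)
have step3 : \sum_(c in A | touches S (S a) c) kappa a c * G - 4 / d *
    (\sum_(c in A | touches S (S a) c)
       \sum_(e in A | touches S (joint S [:: c; a]) e) wt a c e) <=
    \sum_(c in A | touches S (S a) c) Ex (fun E => I' a E * I' c E * softsign' (X' E / d)).
  rewrite mulr_sumr -sumrB; apply: ler_sum => c /andP[cA mc].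
  set D := joint S [:: c; a]; set W := \sum_(e in A | _) _.
  have d2 : 0 <= 2 / d by rewrite divr_ge0 // ltW.
  have lip E : `|softsign' (X' E / d) - softsign' ((X' E - Y D E) / d)| <= 2 / d * `|Y D E|.
    apply: le_trans (softsign'_lip _ _) _.
    have -> : X' E / d - (X' E - Y D E) / d = Y D E / d by field; rewrite gt_eqF.
    by rewrite normrM normfV (gtr0_norm d0) mulrA mulrAC.
  have W1 : Ex (fun E => `|I' a E * I' c E| * `|Y D E|) <= W.
    apply: le_trans (_ : _ <= Ex (fun E => \sum_(e in A | touches S D e)
       `|I' a E * I' c E * I' e E|)) _.
      apply: le_rsexpect => // E _; under eq_bigr do rewrite normrM.
      by rewrite -mulr_sumr ler_wpM2l //; apply: Yle.
    rewrite rsexpect_sum; apply: ler_sum => e /andP[eA _]; exact: ex_triple.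
  have W2 : kappa a c * Ex (fun E => `|Y D E|) <= W.
    apply: le_trans (ler_wpM2l (kappa_ge0 a c) (le_rsexpect hp (fun E _ => Yle D E))) _.
    rewrite rsexpect_sum mulr_sumr; apply: ler_sum => e /andP[eA _]; exact: ex_pair_single.
  have cut : Ex (fun E => I' a E * I' c E * softsign' ((X' E - Y D E) / d)) =
      kappa a c * Ex (fun E => softsign' ((X' E - Y D E) / d)).
    rewrite (@decouple _ _ _ N p A S D (fun x => softsign' (x / d))) ?ex_cind2 //.
    by move=> E; congr (_ * _); apply: cindI; apply: sub_joint; rewrite !inE eqxx ?orbT.
  have lo1 : Ex (fun E => I' a E * I' c E * softsign' ((X' E - Y D E) / d)) - 2 / d * W <=
      Ex (fun E => I' a E * I' c E * softsign' (X' E / d)).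
    apply: le_trans (lerB (lexx _) (ler_wpM2l d2 W1)) _.
    rewrite -rsexpectZ -rsexpectB; apply: le_rsexpect => // E _.
    have h : - (`|I' a E * I' c E| * (2 / d * `|Y D E|)) <=
       I' a E * I' c E * (softsign' (X' E / d) - softsign' ((X' E - Y D E) / d)).
      by apply: le_trans (lerNnormlW (lexx _)); rewrite lerN2 [leLHS]normrM ler_wpM2l.
    by move: h; rewrite mulrBr; lra.
  have lo2 : kappa a c * G - 2 / d * W <=
      kappa a c * Ex (fun E => softsign' ((X' E - Y D E) / d)).
    have h : G - 2 / d * Ex (fun E => `|Y D E|) <= Ex (fun E => softsign' ((X' E - Y D E) / d)).
      rewrite -rsexpectZ -rsexpectB; apply: le_rsexpect => // E _.
      by have := lip E; rewrite ler_norml => /andP[_]; lra.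
    have := ler_wpM2l (kappa_ge0 a c) h; have := ler_wpM2l d2 W2.
    by rewrite mulrBr; lra.
  by rewrite cut in lo1; move: lo1 lo2; lra.
by rewrite mulr_suml; move: step2 step3; rewrite /Y; lra.
Qed.

(** The indicator of |X'| < d is at most 4 h'(X'/d), as h' >= 1/4 on [-1, 1]; Stein's inequality
    controls the mean of the latter. *)
Lemma small_ball (d : R) : 0 < d ->
  Ex (fun E => X' E ^+ 2) * Ex (fun E => (`|X' E| < d)%R%:R) <=
  4 * (d * Ex (fun E => `|X' E|) + 5 * ((stein_const r)%:R * (1 - p) * mu * b ^+ 2) / d).
Proof.
move=> d0; have V0 : 0 <= Ex (fun E => X' E ^+ 2).
  by apply: rsexpect_ge0 => // E _; apply: sqr_ge0.
have h1 : Ex (fun E => (`|X' E| < d)%R%:R) <= 4 * Ex (fun E => softsign' (X' E / d)).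
  rewrite -rsexpectZ; apply: le_rsexpect => // E _; case: ltP => /= hX; last first.
    by rewrite mulr_ge0 ?softsign'_ge0.
  have : `|X' E / d| <= 1 by rewrite normrM normfV (gtr0_norm d0) ler_pdivrMr // mul1r ltW.
  by move/softsign'_ge; lra.
have h2 := stein_softsign d0.
have h3 : 5 * wsum / d <= 5 * ((stein_const r)%:R * (1 - p) * mu * b ^+ 2) / d.
  apply: ler_wpM2r; first by rewrite invr_ge0 ltW.
  by apply: ler_wpM2l => //; apply: wsum_le.
have := ler_wpM2l V0 h1; lra.
Qed.

End Stein.

(** * Lower bound for the variance *)

Section Variance.
Variables (R : realFieldType) (T : finType) (N : {set T}) (p : R).

Lemma sqr_ex_le (f : {set T} -> R) : 0 <= p <= 1 ->
  rsexpect N p f ^+ 2 <= rsexpect N p (fun E => f E ^+ 2).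
Proof.
move=> hp; rewrite -subr_ge0; set m := rsexpect N p f.
have -> : rsexpect N p (fun E => f E ^+ 2) - m ^+ 2 = rsexpect N p (fun E => (f E - m) ^+ 2).
  rewrite [RHS](@eq_rsexpect _ _ _ _ _ (fun E => f E ^+ 2 - (2 * m * f E - m ^+ 2))).
    by rewrite !rsexpectB rsexpectZ rsexpect_cst -/m; ring.
  by move=> E _; ring.
by apply: rsexpect_ge0 => // E _; apply: sqr_ge0.
Qed.

(* Cauchy-Schwarz over the fibres of [rho], which sends a copy of the large graph to a copy
   of the small one inside it: two copies in the same fibre overlap in at least [j] edges. *)
Lemma variance_fibre (U V : finType) (A : {set U}) (B : {set V}) (S : U -> {set T})
    (rho : U -> V) (s j : nat) :
  0 <= p <= 1 -> (forall a, a \in A -> S a \subset N) ->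
  (forall a, a \in A -> rho a \in B) -> (forall a, a \in A -> #|S a| = s) -> (0 < j)%N ->
  (forall a c, a \in A -> c \in A -> rho a = rho c -> (j <= #|S a :&: S c|)%N) ->
  (1 - p) * mcount p A S ^+ 2 <=
  rsexpect N p (fun E => ccount p A S E ^+ 2) * (#|B|%:R * p ^+ j).
Proof.
move=> hp hS hrho hs j0 hj; have /andP[p0 p1] := hp.
rewrite varE //.
have muE : mcount p A S = #|A|%:R * p ^+ s.
  rewrite /mcount (eq_bigr (fun=> p ^+ s)) ?sumr_const ?mulr_natl //.
  by move=> a aA; rewrite /prob1 hs.
have q0 : 0 <= 1 - p by rewrite subr_ge0.
have cardA : #|A|%:R = \sum_(v in B) (\sum_(a in A | rho a == v) 1) :> R.
  transitivity (\sum_(a in A) (1 : R)); first by rewrite sumr_const.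
  exact: partition_big.
(* Cauchy-Schwarz, obtained by expanding the nonnegative double sum of the squares (F v - F w)^2. *)
have CS : #|A|%:R ^+ 2 <= #|B|%:R * \sum_(v in B) (\sum_(a in A | rho a == v) 1) ^+ 2 :> R.
  rewrite cardA; pose F (v : V) := \sum_(a in A | rho a == v) (1 : R).
  rewrite -[X in _ <= _ * X]/(\sum_(v in B) F v ^+ 2) -[X in X ^+ 2 <= _]/(\sum_(v in B) F v).
  have h : 0 <= \sum_(v in B) \sum_(w in B) (F v - F w) ^+ 2 :> R.
    by apply: sumr_ge0 => v _; apply: sumr_ge0 => w _; apply: sqr_ge0.
  have e : \sum_(v in B) \sum_(w in B) (F v - F w) ^+ 2 =
      2 * (#|B|%:R * \sum_(v in B) F v ^+ 2) - 2 * (\sum_(v in B) F v) ^+ 2.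
    rewrite (eq_bigr (fun v => #|B|%:R * F v ^+ 2 + \sum_(w in B) F w ^+ 2
        - 2 * (F v * \sum_(w in B) F w))); last first.
      move=> v _; rewrite (eq_bigr (fun w => F v ^+ 2 + F w ^+ 2 - 2 * (F v * F w))).
        by rewrite sumrB big_split /= sumr_const mulr_natl -!mulr_sumr.
      by move=> w _; ring.
    rewrite sumrB big_split /= sumr_const -!mulr_sumr -mulr_suml -[_ *+ _]mulr_natl expr2; ring.
  by move: h; rewrite e; lra.
have sumE : \sum_(v in B) (\sum_(a in A | rho a == v) 1) ^+ 2 =
    \sum_(a in A) \sum_(c in A | rho c == rho a) 1 :> R.
  rewrite [RHS](partition_big rho (mem B)) //=; apply: eq_bigr => v vB.
  rewrite expr2 mulr_suml; apply: eq_bigr => a /andP[_ /eqP ->].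
  by rewrite mul1r.
rewrite sumE in CS.
(* Keep only pairs in a common fibre. Their union has at most 2s - j edges; the factor [p ^+ j] on
   the right avoids dividing by [p]. *)
have low : (1 - p) * p ^+ (s + s) * (\sum_(a in A) \sum_(c in A | rho c == rho a) 1) <=
    (\sum_(a in A) \sum_(c in A | touches S (S a) c) kappa p S a c) * p ^+ j.
  rewrite mulr_sumr mulr_suml; apply: ler_sum => a aA.
  rewrite mulr_sumr mulr_suml (bigID (fun c => rho c == rho a)) /=.
  rewrite [leRHS](bigID (fun c => rho c == rho a)) /=.
  rewrite [X in _ + X <= _]big1; last by move=> c /andP[/andP[_ ->]].
  rewrite addr0; apply: ler_wpDr.
    by apply: sumr_ge0 => c _; rewrite mulr_ge0 ?kappa_ge0 ?exprn_ge0.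
  have pr c : (c \in A) && (rho c == rho a) && (rho c == rho a) =
      (c \in A) && touches S (S a) c && (rho c == rho a).
    rewrite -andbA andbb -andbA; case cA : (c \in A) => //=.
    case: eqP => e; rewrite ?andbF //.
    by rewrite andbT /touches -card_gt0 (leq_trans j0) ?hj.
  rewrite (eq_bigl _ _ pr); apply: ler_sum => c /andP[/andP[cA mc] /eqP e].
  rewrite mulr1; apply: le_trans (ler_wpM2r (exprn_ge0 _ p0) (kappa_ge hp mc)).
  rewrite -mulrA ler_wpM2l // -exprD; apply: expr_anti => //.
  by rewrite -{1}(hs a aA) -(hs c cA) -cardsUI leq_add2l hj //; apply/esym/eqP.
rewrite muE.
have c1 : 0 <= (1 - p) * p ^+ (s + s) by rewrite mulr_ge0 ?exprn_ge0.
have h1 := ler_wpM2l c1 CS.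
have h2 := ler_wpM2l (ler0n R #|B|) low.
by move: h1 h2; rewrite exprD; lra.
Qed.

End Variance.

(** * Copies of rooted graphs *)

(** Add the points of [D] one at a time, correcting the permutation by a transposition that fixes
    the values already matched. This is the source of transitivity on copies. *)
Lemma perm_extend (aT T : finType) (D : {set aT}) (f g : aT -> T) :
  {in D &, injective f} -> {in D &, injective g} ->
  exists s : {perm T}, {in D, forall i, s (f i) = g i}.
Proof.
elim/set_ind_add: D => [|a D aD IH] fi gi; first by exists (perm.perm_one T) => i; rewrite inE.
have sD : {subset D <= a |: D} by move=> i iD; rewrite inE iD orbT.
have [s hs] := IH (sub_in2 sD fi) (sub_in2 sD gi).
exists (s * tperm (s (f a)) (g a))%g => i; rewrite permM !inE => /orP[/eqP->|iD].
  by rewrite tpermL.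
have ai : i != a by apply: contraNneq aD => <-.
rewrite (hs i iD) tpermD //; last first.
  by apply: contra_neq ai => /esym/gi -> //; rewrite ?setU11 ?sD.
by rewrite -(hs i iD) (inj_eq perm_inj); apply: contra_neq ai => /esym/fi -> //; rewrite ?setU11 ?sD.
Qed.

Lemma imset_inj_in (aT rT : finType) (D A B : {set aT}) (f : aT -> rT) :
  {in D &, injective f} -> A \subset D -> B \subset D -> f @: A = f @: B -> A = B.
Proof.
move=> fi sA sB e; wlog suff: A B sA sB e / A \subset B => [h|].
  by apply/eqP; rewrite eqEsubset; apply/andP; split; apply: h.
apply/subsetP => i iA; have : f i \in f @: B by rewrite -e imset_f.
by case/imsetP => j jB /fi -> //; [exact: (subsetP sA)|exact: (subsetP sB)].
Qed.

Section Copies.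
Variables (vG m : nat) (EH : {set {set 'I_(vG + m)}}).
Hypothesis hH : rooted_graph EH.
Local Notation k := (vG + m)%N.
Local Notation re := (root_edges EH).
Local Notation graph := ({set 'I_k} * {set {set 'I_k}})%type.
Implicit Types (J : graph).

Definition new_edges J := J.2 :\: re.
Definition image_of n (phi : {ffun 'I_k -> 'I_n}) J := (phi @: J.1, edge_img phi (new_edges J)).
(** Extensions in the complete graph, that is, all potential copies; being present in a random graph
    then means inclusion of the edge set. *)
Definition copies n J (x : {ffun 'I_vG -> 'I_n}) := extensions EH J x (pairs n).
Definition emb n J (x : {ffun 'I_vG -> 'I_n}) (phi : {ffun 'I_k -> 'I_n}) :=
  {in J.1 &, injective phi} /\ forall j, phi (lshift m j) = x j.

Lemma sub_edges : EH \subset pairs k. Proof. by case/andP: hH. Qed.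

Lemma full_sub_rooted : sub_rooted EH (fullJ EH).
Proof.
case/andP: hH => _ h; rewrite /sub_rooted /= subsetT subxx h !andbT /=.
apply/andP; split; last by apply/'forall_implyP => e _; rewrite subsetT.
by apply/subsetP => e; rewrite inE => /andP[].
Qed.

Lemma sub_rootedP J : sub_rooted EH J ->
  [/\ Defs.roots vG m \subset J.1, J.2 \subset EH, forall e, e \in J.2 -> e \subset J.1,
      re \subset J.2 & (0 < #|new_edges J|)%N].
Proof.
case/and5P=> h1 h2 h3 /'forall_implyP h4 h5; split=> //.
by rewrite cardsD (setIidPr h2) subn_gt0.
Qed.

Lemma extP n J (x : {ffun 'I_vG -> 'I_n}) (Gam : {set {set 'I_n}}) al :
  reflect (exists2 phi, emb J x phi & al = image_of phi J /\ (image_of phi J).2 \subset Gam)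
    (al \in extensions EH J x Gam).
Proof.
apply: (iffP imsetP) => [[phi]|[phi [h1 h2] [-> h3]]].
  rewrite inE => /and3P[/'forall_implyP h1 /forallP h2 h3] ->; exists phi => //; split.
    by move=> i j iJ jJ /eqP e; apply/eqP; have /'forall_implyP/(_ j jJ)/implyP := h1 i iJ; apply.
  by move=> j; apply/eqP.
exists phi => //; rewrite inE h3 andbT; apply/andP; split; last by apply/forallP => j; apply/eqP.
apply/'forall_implyP => i iJ; apply/'forall_implyP => j jJ; apply/implyP => /eqP e.
by apply/eqP; apply: h1.
Qed.

Section Admissible.
Variable J : graph.
Hypothesis hJ : sub_rooted EH J.

Lemma new_edge_sub e : e \in new_edges J -> e \subset J.1.
Proof. by have [_ _ h _ _] := sub_rootedP hJ; rewrite inE => /andP[_]; apply: h. Qed.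

Lemma card_image_edges n (phi : {ffun 'I_k -> 'I_n}) : {in J.1 &, injective phi} ->
  #|(image_of phi J).2| = #|new_edges J|.
Proof.
move=> hi; rewrite card_in_imset // => e f eJ fJ.
by apply: (imset_inj_in hi); apply: new_edge_sub.
Qed.

Lemma image_pairs n (phi : {ffun 'I_k -> 'I_n}) : {in J.1 &, injective phi} ->
  (image_of phi J).2 \subset pairs n.
Proof.
move=> hi; apply/subsetP => _ /imsetP[e eJ ->]; rewrite inE.
rewrite card_in_imset; last by apply: sub_in2 hi; apply/subsetP; apply: new_edge_sub.
have [_ s _ _ _] := sub_rootedP hJ; move: eJ; rewrite inE => /andP[_] /(subsetP s) /(subsetP sub_edges).
by rewrite inE.
Qed.

Lemma copiesP n (x : {ffun 'I_vG -> 'I_n}) al :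
  reflect (exists2 phi, emb J x phi & al = image_of phi J) (al \in copies J x).
Proof.
apply: (iffP (extP _ _ _ _)) => [[phi h []]|[phi h ->]]; exists phi => //.
by split=> //; apply: image_pairs; case: h.
Qed.

Lemma copies_card n (x : {ffun 'I_vG -> 'I_n}) al : al \in copies J x ->
  #|al.2| = #|new_edges J|.
Proof. by case/copiesP=> phi [h _] ->; apply: card_image_edges. Qed.

Lemma copies_pairs n (x : {ffun 'I_vG -> 'I_n}) al : al \in copies J x -> al.2 \subset pairs n.
Proof. by case/copiesP=> phi [h _] ->; apply: image_pairs. Qed.

Lemma extensionsE n (x : {ffun 'I_vG -> 'I_n}) (Gam : {set {set 'I_n}}) :
  Gam \subset pairs n ->
  extensions EH J x Gam = [set al in copies J x | al.2 \subset Gam].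
Proof.
move=> sG; apply/setP => al; rewrite inE; apply/extP/andP => [[phi h [-> s]]|[]].
  by split=> //; apply/copiesP; exists phi.
by case/copiesP=> phi h -> s; exists phi.
Qed.

End Admissible.

(** * Symmetry and double counting of copies *)

Definition relabel n (s : {perm 'I_n}) (al : {set 'I_n} * {set {set 'I_n}}) :=
  (s @: al.1, [set s @: (e : {set 'I_n}) | e in al.2]).
Definition contained n (al be : {set 'I_n} * {set {set 'I_n}}) : bool :=
  (al.1 \subset be.1) && (al.2 \subset be.2).

Lemma relabel_inj n (s : {perm 'I_n}) : injective (relabel s).
Proof.
have si : injective (fun e : {set 'I_n} => s @: e) by apply: imset_inj; apply: perm_inj.
by move=> [V E] [V' E'] [/si -> /(imset_inj si) ->].
Qed.

Lemma relabel_contained n (s : {perm 'I_n}) al be : contained al be -> contained (relabel s al) (relabel s be).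
Proof. by case/andP=> h1 h2; rewrite /contained /relabel /= !imsetS. Qed.

Lemma relabel_image n (s : {perm 'I_n}) J (phi psi : {ffun 'I_k -> 'I_n}) : sub_rooted EH J ->
  {in J.1, forall i, s (phi i) = psi i} -> relabel s (image_of phi J) = image_of psi J.
Proof.
move=> hJ h; rewrite /relabel /image_of /=; congr (_, _).
  by rewrite -imset_comp; apply: eq_in_imset.
rewrite /edge_img -imset_comp; apply: eq_in_imset => e eJ /=; rewrite -imset_comp.
by apply: eq_in_imset => i ie; apply: h; apply: (subsetP (new_edge_sub hJ eJ)).
Qed.

Lemma relabel_copies n (s : {perm 'I_n}) J (x y : {ffun 'I_vG -> 'I_n}) al : sub_rooted EH J ->
  (forall j, s (x j) = y j) -> al \in copies J x -> relabel s al \in copies J y.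
Proof.
move=> hJ h /(copiesP hJ) [phi [h1 h2] ->]; apply/(copiesP hJ).
exists [ffun i => s (phi i)]; last by apply: relabel_image => // i _; rewrite ffunE.
by split=> [i j iJ jJ|j]; rewrite !ffunE ?h2 // => /perm_inj; apply: h1.
Qed.

Lemma card_copies_eq n J (x y : {ffun 'I_vG -> 'I_n}) : sub_rooted EH J ->
  injective x -> injective y -> #|copies J x| = #|copies J y|.
Proof.
move=> hJ; wlog suff: x y / injective x -> injective y -> (#|copies J x| <= #|copies J y|)%N.
  by move=> h xi yi; apply/eqP; rewrite eqn_leq; apply/andP; split; apply: h.
move=> xi yi; have [s hs] := @perm_extend _ _ [set: 'I_vG] x y (in2W xi) (in2W yi).
rewrite -(card_imset (copies J x) (@relabel_inj n s)); apply: subset_leq_card.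
by apply/subsetP => _ /imsetP[al alx ->]; apply: relabel_copies alx => // j; apply: hs.
Qed.

Local Notation H := (fullJ EH).
Local Notation hHH := full_sub_rooted.

Definition above n (x : {ffun 'I_vG -> 'I_n}) al := [set be in copies H x | contained al be].

(** A permutation carrying [al] to [be] fixes the tuple [x], because the roots belong to J; so it
    maps copies of H above [al] injectively to copies above [be]. *)
Lemma card_above_eq n J (x : {ffun 'I_vG -> 'I_n}) al be : sub_rooted EH J ->
  al \in copies J x -> be \in copies J x -> #|above x al| = #|above x be|.
Proof.
move=> hJ; wlog suff: al be / al \in copies J x -> be \in copies J x ->
    (#|above x al| <= #|above x be|)%N.
  by move=> h xi yi; apply/eqP; rewrite eqn_leq; apply/andP; split; apply: h.
move=> /(copiesP hJ)[phi [f1 f2] ->] /(copiesP hJ)[psi [g1 g2] ->].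
have [s hs] := perm_extend f1 g1; have [hr _ _ _ _] := sub_rootedP hJ.
rewrite -(card_imset (above x _) (@relabel_inj n s)); apply: subset_leq_card.
apply/subsetP => _ /imsetP[ga + ->]; rewrite inE => /andP[gx sg]; rewrite inE.
apply/andP; split; last by rewrite -(relabel_image hJ hs); apply: relabel_contained.
apply: (relabel_copies hHH _ gx) => j; rewrite -{1}f2 hs ?g2 //.
by apply: (subsetP hr); apply: imset_f.
Qed.

(** Bounds the number of pairs of a vertex subset and an edge subset of one copy of H. *)
Definition subcount : nat := (2 ^ k * 2 ^ #|new_edges H|)%N.

(** Count pairs of a copy of J inside a copy of H in two ways: each copy of J lies in equally many
    copies of H, and each copy of H contains at most [subcount] copies of J. *)
Lemma above_bound n J (x : {ffun 'I_vG -> 'I_n}) al : sub_rooted EH J ->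
  al \in copies J x -> (#|above x al| * #|copies J x| <= subcount * #|copies H x|)%N.
Proof.
move=> hJ alx.
have -> : (#|above x al| * #|copies J x| =
    \sum_(be in copies J x) \sum_(ga in copies H x | contained be ga) 1)%N.
  rewrite mulnC -sum_nat_const; apply: eq_bigr => be bex.
  by rewrite (card_above_eq hJ alx bex) -sum1_card; apply: eq_bigl => ga; rewrite inE.
rewrite (exchange_big_dep (mem (copies H x))) /=; last by move=> ? ? _ /andP[].
rewrite mulnC -sum_nat_const; apply: leq_sum => ga gax.
rewrite sum1_card -sum1_card (eq_bigl (mem [set be in copies J x | contained be ga])); last first.
  by move=> be; rewrite !inE gax.
rewrite sum1_card; apply: (@leq_trans #|setX (powerset ga.1) (powerset ga.2)|).
  by apply: subset_leq_card; apply/subsetP => -[V E]; rewrite !inE => /andP[_].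
rewrite cardsX !card_powerset /subcount; apply: leq_mul.
  rewrite leq_exp2l //; case/(copiesP hHH): gax => phi _ -> /=.
  by apply: leq_trans (leq_imset_card _ _) _; rewrite cardsT card_ord.
by rewrite (copies_card hHH gax).
Qed.

Lemma subcopy n J (x : {ffun 'I_vG -> 'I_n}) al : sub_rooted EH J -> al \in copies H x ->
  exists be, be \in copies J x /\ be.2 \subset al.2.
Proof.
move=> hJ /(copiesP hHH)[phi [h1 h2] ->]; exists (image_of phi J); split.
  by apply/(copiesP hJ); exists phi => //; split=> // i j _ _; apply: h1; rewrite inE.
by apply: imsetS; apply: setSD; have [_ s _ _ _] := sub_rootedP hJ.
Qed.

Lemma copy_edge_sub n (x : {ffun 'I_vG -> 'I_n}) ga e : ga \in copies H x ->
  e \in ga.2 -> e \subset ga.1.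
Proof. by case/(copiesP hHH)=> phi _ -> /imsetP[f _ ->]; apply: imsetS; apply: subsetT. Qed.

Lemma copy_root n (x : {ffun 'I_vG -> 'I_n}) ga j : ga \in copies H x -> x j \in ga.1.
Proof. by case/(copiesP hHH)=> phi [_ <-] ->; apply: imset_f; rewrite inE. Qed.

(** Pulling the shared edges back along the embedding of [ga] gives an admissible J, with at least
    one new edge because the overlap is nonempty. *)
Lemma trace_copy n (x : {ffun 'I_vG -> 'I_n}) (D : {set {set 'I_n}}) ga :
  ga \in copies H x -> ga.2 :&: D != set0 ->
  exists J al, [/\ sub_rooted EH J, al \in copies J x, al.2 = ga.2 :&: D &
    forall be, be \in copies H x -> al.2 \subset be.2 -> contained al be].
Proof.
move=> gx; have /(copiesP hHH)[phi [h1 h2] eg] := gx; rewrite eg => nD.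
pose F := [set e in new_edges H | phi @: e \in D].
(* J has no vertices beyond the roots and the endpoints of [F], so a copy of H that contains the
   edges of [al] also contains its vertices. *)
pose J : graph := (Defs.roots vG m :|: \bigcup_(e in F) e, re :|: F).
have FnH : F \subset new_edges H by apply/subsetP => e; rewrite inE => /andP[].
have neJ : new_edges J = F.
  apply/setP => e; rewrite /new_edges /J /= !in_setD in_setU.
  case ef : (e \in F); rewrite ?orbT ?orbF ?andbT ?andNb //.
  by have := subsetP FnH e ef; rewrite inE => /andP[].
have imF : edge_img phi F = (image_of phi H).2 :&: D.
  apply/setP => f; rewrite inE; apply/imsetP/andP => [[e]|[/imsetP[e eH ->] fD]].
    by rewrite inE => /andP[eH eD] ->; split=> //; apply: imset_f.
  by exists e => //; rewrite inE eH.
have F0 : F != set0.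
  by apply: contraNneq nD => F0; rewrite -imF F0 /edge_img imset0.
have rH : re \subset EH by apply/subsetP => e; rewrite inE => /andP[].
have hJ : sub_rooted EH J.
  apply/and5P; split => /=.
  - exact: subsetUl.
  - exact: subsetUl.
  - by rewrite subUset rH (subset_trans FnH) // subsetDl.
  - apply/'forall_implyP => e; rewrite in_setU => /orP[|eF].
      by rewrite inE => /andP[_ s]; apply: subset_trans s (subsetUl _ _).
    by apply: subset_trans (subsetUr _ _); apply: (bigcup_sup e).
  - apply: proper_card; rewrite properE subsetUl /=.
    have [e eF] := set0Pn _ F0; apply/subsetPn; exists e; first by rewrite in_setU eF orbT.
    by have := subsetP FnH e eF; rewrite inE => /andP[].
exists J, (image_of phi J); split => //.
- by apply/(copiesP hJ); exists phi => //; split=> // i j _ _; apply: h1; rewrite inE.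
- by rewrite /image_of /= neJ.
move=> be bx s; rewrite /contained s andbT; apply/subsetP => _ /imsetP[i iJ ->].
move: iJ; rewrite in_setU => /orP[/imsetP[j _ ->]|/bigcupP[e eF ie]].
  by rewrite h2; apply: copy_root.
have eb : phi @: e \in be.2 by apply: (subsetP s); rewrite /= neJ; apply: imset_f.
by apply: (subsetP (copy_edge_sub bx eb)); apply: imset_f.
Qed.

(** * Expected counts, neighbourhood sums and variance of extension counts *)

Variable R : realType.

Lemma ex_copies n J (p : R) (x : {ffun 'I_vG -> 'I_n}) : sub_rooted EH J ->
  rsexpect (pairs n) p (fun E => \sum_(al in copies J x) (al.2 \subset E)%:R) =
  #|copies J x|%:R * p ^+ #|new_edges J|.
Proof.
move=> hJ; rewrite rsexpect_sum (eq_bigr (fun=> p ^+ #|new_edges J|)).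
  by rewrite sumr_const mulr_natl.
move=> al ax; rewrite rsexpect_contains ?(copies_card hJ ax) //.
exact: copies_pairs ax.
Qed.

Lemma mu_extE n J (p : R) (x : {ffun 'I_vG -> 'I_n}) : sub_rooted EH J -> injective x ->
  Defs.mu_ext EH J n p = #|copies J x|%:R * p ^+ #|new_edges J|.
Proof.
move=> hJ xi; rewrite /Defs.mu_ext; case: pickP => [y /injectiveP yi|/(_ x)]; last first.
  by move/negP; case; apply/injectiveP.
rewrite (card_copies_eq hJ xi yi) -ex_copies //.
apply: eq_rsexpect => E sE; rewrite /Xext (extensionsE hJ _ sE).
rewrite -sum1_card natr_sum big_mkcond [RHS]big_mkcond /=; apply: eq_bigr => al _.
by rewrite inE; case: (al \in _); case: (al.2 \subset E).
Qed.

Lemma muGH_mcount n (p : R) (x : {ffun 'I_vG -> 'I_n}) : injective x ->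
  muGH EH n p = mcount p (copies H x) snd.
Proof.
move=> xi; rewrite /muGH (mu_extE p hHH xi) /mcount.
rewrite (eq_bigr (fun=> p ^+ #|new_edges H|)) ?sumr_const ?mulr_natl //.
by move=> al ax; rewrite /prob1 (copies_card hHH ax).
Qed.

Lemma XGH_ccount n (p : R) (x : {ffun 'I_vG -> 'I_n}) (E : {set {set 'I_n}}) : injective x -> E \subset pairs n ->
  XGH R EH x E - muGH EH n p = ccount p (copies H x) snd E.
Proof.
move=> xi sE; rewrite (muGH_mcount p xi) /ccount sumrB; congr (_ - _).
rewrite /XGH /Xext (extensionsE hHH _ sE) -sum1_card natr_sum big_mkcond [RHS]big_mkcond /=.
by apply: eq_bigr => al _; rewrite inE /ind; case: (al \in _); case: (al.2 \subset E).
Qed.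

Lemma Phi_attained n (p : R) : exists2 J, sub_rooted EH J & PhiGH EH n p = Defs.mu_ext EH J n p.
Proof.
rewrite /PhiGH; apply: (big_ind (fun y => exists2 J, sub_rooted EH J & y = Defs.mu_ext EH J n p)).
- by exists H => //; apply: hHH.
- by move=> y z [J hJ ->] [J' hJ' ->]; rewrite /Num.min; case: ifP => _; [exists J|exists J'].
- by move=> J hJ; exists J.
Qed.

Lemma Phi_le n (p : R) J : sub_rooted EH J -> PhiGH EH n p <= Defs.mu_ext EH J n p.
Proof. by move=> hJ; apply: bigmin_le_cond. Qed.

(** The power of 2 counts the possible overlaps with the edges of [K] copies. *)
Definition near_const (K : nat) : nat := (2 ^ (K * #|new_edges H|) * subcount)%N.

(** Sort the copies by their overlap with the joint edge set. A given overlap is a copy of some J,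
    and the copies of H above it weigh at most [subcount] times mu_H / mu_J, hence at most
    [subcount] times mu / Phi. *)
Lemma near_bound n (p : R) (x : {ffun 'I_vG -> 'I_n}) K : 0 <= p <= 1 -> injective x ->
  0 < PhiGH EH n p ->
  forall l : seq ({set 'I_n} * {set {set 'I_n}}), (size l <= K)%N -> all (mem (copies H x)) l ->
  \sum_(c in copies H x | touches snd (joint snd l) c) p ^+ #|c.2 :\: joint snd l| <=
  (near_const K)%:R * (muGH EH n p / PhiGH EH n p).
Proof.
move=> /andP[p0 p1] xi Phi0 l sl lx; set D := joint snd l.
have mu0 : 0 <= muGH EH n p by rewrite (muGH_mcount p xi) mcount_ge0 // p0 p1.
have cD : (#|D| <= K * #|new_edges H|)%N.
  apply: (@leq_trans (size l * #|new_edges H|)); last by rewrite leq_mul2r sl orbT.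
  rewrite /D; elim: (l) lx => [|a l' IH] /=; first by rewrite /joint big_nil cards0.
  case/andP=> ax lx; rewrite joint_cons mulSn; apply: leq_trans (leq_card_setU _ _) _.
  by apply: leq_add; [rewrite (copies_card hHH ax)|apply: IH].
rewrite (partition_big (fun c : {set 'I_n} * {set {set 'I_n}} => c.2 :&: D)
  (mem (powerset D))) /=; last by move=> c _; rewrite inE subsetIr.
apply: (@le_trans _ _ (\sum_(D' in powerset D) subcount%:R * (muGH EH n p / PhiGH EH n p))).
  apply: ler_sum => D' _.
  pose P (c : {set 'I_n} * {set {set 'I_n}}) :=
    (c \in copies H x) && touches snd D c && (c.2 :&: D == D').
  rewrite (eq_bigl P) //.
  have [ga Pga|P0] := pickP P; last first.
    by rewrite big_pred0 // mulr_ge0 ?ler0n // divr_ge0 // ltW.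
  have /andP[/andP[gx gD] /eqP gD'] := Pga.
  have [J [al [hJ ax aD hal]]] := trace_copy gx gD.
  have cJ : #|D'| = #|new_edges J| by rewrite -gD' -aD (copies_card hJ ax).
  have muJ := mu_extE p hJ xi.
  have muJ0 : 0 < Defs.mu_ext EH J n p by apply: lt_le_trans Phi0 (Phi_le n p hJ).
  apply: (@le_trans _ _ (subcount%:R * (muGH EH n p / Defs.mu_ext EH J n p))); last first.
    rewrite ler_wpM2l ?ler0n // ler_wpM2l // lef_pV2 ?posrE //; exact: Phi_le.
  rewrite mulrA ler_pdivlMr // muJ /muGH (mu_extE p hHH xi).
  (* All copies with overlap [D'] contain the same copy [al] of J, and each has exactly e_H - e_J
     edges outside [D]. *)
  have sumle : \sum_(c | P c) p ^+ #|c.2 :\: D| <=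
      #|above x al|%:R * p ^+ (#|new_edges H| - #|new_edges J|).
    rewrite mulr_natl -sumr_const; rewrite [leRHS](bigID P) /=; apply: ler_wpDr.
      by apply: sumr_ge0 => *; apply: exprn_ge0.
    rewrite le_eqVlt; apply/orP; left; apply/eqP; apply: eq_big => c.
      case Pc : (P c); rewrite ?andbF // andbT.
      have /andP[/andP[cx _] /eqP cD'] := Pc.
      by rewrite inE cx hal // aD gD' -cD' subsetIl.
    move=> Pc; have /andP[/andP[cx _] /eqP cD'] := Pc.
    by rewrite cardsD cD' cJ (copies_card hHH cx).
  have leJH : (#|new_edges J| <= #|new_edges H|)%N.
    by apply: subset_leq_card; apply: setSD; have [_ s _ _ _] := sub_rootedP hJ.
  have c0 : 0 <= #|copies J x|%:R * p ^+ #|new_edges J|.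
    by rewrite mulr_ge0 ?ler0n ?exprn_ge0.
  apply: le_trans (ler_wpM2r c0 sumle) _.
  rewrite mulrACA -natrM -exprD subnK // mulrA -natrM.
  by apply: ler_wpM2r; [apply: exprn_ge0|rewrite ler_nat; apply: above_bound].
rewrite sumr_const card_powerset -[leLHS]mulr_natl /near_const [in leRHS]natrM -mulrA.
rewrite ler_wpM2r //; first by rewrite mulr_ge0 ?ler0n // divr_ge0 // ltW.
by rewrite ler_nat leq_exp2l.
Qed.

Lemma variance_ge n (p : R) (x : {ffun 'I_vG -> 'I_n}) : 0 <= p <= 1 -> injective x ->
  (1 - p) * muGH EH n p ^+ 2 <=
  rsexpect (pairs n) p (fun E => ccount p (copies H x) snd E ^+ 2) * PhiGH EH n p.
Proof.
move=> hp xi; have [J hJ ->] := Phi_attained n p.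
rewrite (mu_extE p hJ xi) (muGH_mcount p xi).
(* Choose a copy of the minimizing J inside each copy of H. The default [al] never occurs on copies
   of H, by [subcopy]. Copies in one fibre share all new edges of the chosen copy. *)
pose rho (al : {set 'I_n} * {set {set 'I_n}}) :=
  odflt al [pick be in copies J x | be.2 \subset al.2].
have rhoP al : al \in copies H x -> rho al \in copies J x /\ (rho al).2 \subset al.2.
  move=> ax; rewrite /rho; case: pickP => [be /andP[]|no] //=.
  by have [be [b1 b2]] := subcopy hJ ax; have := no be; rewrite b1 b2.
have [_ _ _ _ j0] := sub_rootedP hJ.
apply: (@variance_fibre _ _ _ _ _ _ _ _ _ rho #|new_edges H|) => //.
- by move=> a ax; apply: (copies_pairs hHH ax).
- by move=> a /rhoP[].
- by move=> a ax; apply: (copies_card hHH ax).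
move=> a c ax cx e; have [r1 r2] := rhoP a ax; have [r3 r4] := rhoP c cx.
by rewrite -(copies_card hJ r1) subset_leq_card // subsetI r2 e.
Qed.

End Copies.

(** * Deviations of extension counts *)

Section Tails.
Variables (R : realType) (vG m : nat) (EH : {set {set 'I_(vG + m)}}).
Hypothesis hH : rooted_graph EH.
Variables (n : nat) (p : R).
Hypothesis hp : 0 <= p <= 1.

Local Notation H := (fullJ EH).
Local Notation mu := (muGH EH n p).
Local Notation Phi := (PhiGH EH n p).
Local Notation dev x E := (XGH R EH x E - mu).
Implicit Types (x : {ffun 'I_vG -> 'I_n}) (E : {set {set 'I_n}}).

Lemma gnp_probE (A : pred {set {set 'I_n}}) :
  gnp_prob p A = rsexpect (pairs n) p (fun E => (A E)%:R).
Proof. by []. Qed.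

Lemma gnp_prob_le1 (A : pred {set {set 'I_n}}) : gnp_prob p A <= 1.
Proof.
rewrite gnp_probE -[leRHS](rsexpect1 p (pairs n)); apply: le_rsexpect => // E _.
by case: (A E).
Qed.

Lemma gnp_prob_ge (A : pred {set {set 'I_n}}) (f : {set {set 'I_n}} -> R) :
  (forall E, E \subset pairs n -> ~~ A E -> 1 <= f E) ->
  (forall E, 0 <= f E) -> 1 - rsexpect (pairs n) p f <= gnp_prob p A.
Proof.
move=> hf f0; rewrite gnp_probE -[X in X - _](rsexpect1 p (pairs n)) -rsexpectB.
apply: le_rsexpect => // E sE; case AE : (A E) => /=.
  by rewrite lerBlDr lerDl.
by rewrite subr_le0 hf // AE.
Qed.

(** With b = B mu / Phi and Phi >= c one has mu + b <= (1 + B / c) mu, so (mu + b) b is at most (1 +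
    B / c) B mu^2 / Phi. *)
Definition tail_const (k : nat) (c : R) : R :=
  let B := (near_const EH k.+1.*2)%:R in moment_const R k * ((1 + B / c) * B) ^+ k.+1.

Lemma tail_const_ge0 k (c : R) : 0 < c -> 0 <= tail_const k c.
Proof.
move=> c0; have B0 := ler0n R (near_const EH k.+1.*2).
rewrite /tail_const mulr_ge0 //.
  by rewrite !mulr_ge0 ?exprn_ge0 ?addr_ge0 ?mulr_ge0 ?exprn_ge0 ?mulr_ge0 ?ler0n.
by rewrite exprn_ge0 // mulr_ge0 // addr_ge0 // divr_ge0 // ltW.
Qed.

Lemma mu_ge0 x : injective x -> 0 <= mu.
Proof. by move=> xi; rewrite (muGH_mcount hH p xi) mcount_ge0. Qed.

Lemma Phi_le_mu : Phi <= mu.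
Proof. exact: Phi_le (full_sub_rooted hH). Qed.

(** Markov's inequality for the central moment of order 2(k + 1). *)
Lemma deviation_tail x k (c t : R) : injective x -> 0 < c -> c <= Phi -> 0 < t ->
  gnp_prob p (fun E => t <= `|dev x E|) <=
  tail_const k c * ((t / mu) ^+ 2 * Phi) ^- k.+1.
Proof.
move=> xi c0 cPhi t0; have Phi0 := lt_le_trans c0 cPhi.
have mu0 := lt_le_trans Phi0 Phi_le_mu.
set B : R := (near_const EH k.+1.*2)%:R; have B0 : 0 <= B by apply: ler0n.
set b := B * (mu / Phi).
have b0 : 0 <= b by rewrite mulr_ge0 // divr_ge0 // ltW.
have hS a : a \in copies EH H x -> a.2 \subset pairs n.
  by move=> ax; apply: (copies_pairs hH (full_sub_rooted hH) ax).
have cm := central_moment hp hS (near_bound hH hp xi Phi0) (leqnn k.+1.*2).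
rewrite -(muGH_mcount hH p xi) -/B -/b in cm.
have tk : 0 < t ^+ k.+1.*2 by rewrite exprn_gt0.
apply: (@le_trans _ _ (rsexpect (pairs n) p
   (fun E => ccount p (copies EH H x) snd E ^+ k.+1.*2) / t ^+ k.+1.*2)).
  rewrite gnp_probE -rsexpectZr; apply: le_rsexpect => // E sE.
  rewrite (XGH_ccount hH p xi sE); case: (leP t `|_|) => /= h.
    rewrite ler_pdivlMr // mul1r -[leRHS]ger0_norm ?exprn_even_ge0 ?odd_double //.
    by rewrite normrX; apply: lerXn2r; rewrite ?nnegrE // ltW.
  by rewrite divr_ge0 ?exprn_even_ge0 ?odd_double // ltW.
rewrite ler_pdivrMr //; apply: le_trans cm _.
have bB : (mu + b) * b <= (1 + B / c) * B * (mu ^+ 2 / Phi).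
  have h : mu + b <= (1 + B / c) * mu.
    rewrite mulrDl mul1r lerD2l /b mulrA [leRHS]mulrAC ler_wpM2l ?mulr_ge0 ?(ltW mu0) //.
    by rewrite lef_pV2 ?posrE.
  have -> : (1 + B / c) * B * (mu ^+ 2 / Phi) = (1 + B / c) * mu * b by rewrite /b; ring.
  by rewrite ler_wpM2r.
have m0 : 0 <= moment_const R k.
  by rewrite /moment_const !mulr_ge0 ?exprn_ge0 ?addr_ge0 ?mulr_ge0 ?exprn_ge0 ?mulr_ge0 ?ler0n.
have mb0 : 0 <= (mu + b) * b by rewrite mulr_ge0 // addr_ge0 // ltW.
rewrite [leRHS](_ : _ = moment_const R k *
  (((1 + B / c) * B) ^+ k.+1 * (((t / mu) ^+ 2 * Phi) ^- k.+1 * t ^+ k.+1.*2))); last first.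
  by rewrite /tail_const -/B -!(mulrA (moment_const R k)) -(mulrA (_ ^+ _)).
apply: ler_wpM2l => //.
have e : ((1 + B / c) * B) ^+ k.+1 * (((t / mu) ^+ 2 * Phi) ^- k.+1 * t ^+ k.+1.*2) =
    ((1 + B / c) * B * (mu ^+ 2 / Phi)) ^+ k.+1.
  rewrite -mul2n exprM -exprVn -!exprMn; congr (_ ^+ _).
  by field; rewrite !gt_eqF.
rewrite e; apply: lerXn2r; rewrite ?nnegrE //; exact: le_trans bB.
Qed.

Lemma all_concentrated k (c t : R) : 0 < c -> c <= Phi -> 0 < t ->
  1 - (n ^ vG)%:R * (tail_const k c * ((t / mu) ^+ 2 * Phi) ^- k.+1) <=
  gnp_prob p (fun E => [forall x : {ffun 'I_vG -> 'I_n}, injectiveb x ==> (`|dev x E| < t)]).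
Proof.
move=> c0 cPhi t0.
have hmean := @gnp_prob_ge (fun E => [forall x : {ffun 'I_vG -> 'I_n}, injectiveb x ==> (`|dev x E| < t)])
  (fun E => \sum_(x : {ffun 'I_vG -> 'I_n} | injectiveb x) (t <= `|dev x E|)%R%:R).
apply: le_trans (hmean _ _); last 2 first.
- move=> E _; rewrite negb_forall => /existsP[x]; rewrite negb_imply -leNgt => /andP[xi h].
  by rewrite (bigD1 x) //= h lerDl sumr_ge0.
- by move=> E; apply: sumr_ge0.
rewrite lerB // rsexpect_sum.
set y := tail_const _ _ * _.
have y0 : 0 <= y.
  rewrite /y mulr_ge0 ?tail_const_ge0 // invr_ge0 exprn_ge0 // mulr_ge0 ?sqr_ge0 //.
  exact: ltW (lt_le_trans c0 cPhi).
apply: (@le_trans _ _ (\sum_(x : {ffun 'I_vG -> 'I_n}) y)); last first.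
  by rewrite sumr_const card_ffun !card_ord mulr_natl.
rewrite [leRHS](bigID (fun x : {ffun 'I_vG -> 'I_n} => injectiveb x)) /=; apply: ler_wpDr; first exact: sumr_ge0.
by apply: ler_sum => x /injectiveP xi; apply: deviation_tail.
Qed.

(** The factor 20 is 4 times 5, both from [small_ball]; the square comes from b^2 in the bound on
    [wsum]. *)
Definition ball_const : R :=
  20 * (stein_const #|new_edges EH H|)%:R * (near_const EH 2)%:R ^+ 2.

(** A single tuple suffices. With s the standard deviation of X', the variance bound gives eps mu <=
    delta s, so the small-ball estimate applies at radius delta s. Its error term is O(1 / (delta
    L)), because s >= L mu / Phi. *)
Lemma one_deviates x (eps delta L : R) : injective x -> 0 < eps -> 0 < delta -> 0 < L ->
  L ^+ 2 <= Phi * (1 - p) -> eps ^+ 2 * Phi / (1 - p) <= delta ^+ 2 ->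
  1 - (4 * delta + ball_const / (delta * L)) <=
  gnp_prob p (fun E => [exists x : {ffun 'I_vG -> 'I_n}, injectiveb x && (eps * mu <= `|dev x E|)]).
Proof.
move=> xi eps0 delta0 L0 hL heps.
have q0 : 0 <= 1 - p by case/andP: hp => _; rewrite subr_ge0.
have Pq : 0 < Phi * (1 - p) by apply: lt_le_trans hL; rewrite exprn_gt0.
have q1 : 0 < 1 - p by rewrite lt_def q0 andbT; apply: contraTneq Pq => ->; rewrite mulr0 ltxx.
have Phi0 : 0 < Phi by rewrite pmulr_lgt0 in Pq.
have mu0 := lt_le_trans Phi0 Phi_le_mu.
set X' := ccount p (copies EH H x) snd.
set V := rsexpect (pairs n) p (fun E => X' E ^+ 2).
have hV : (1 - p) * mu ^+ 2 / Phi <= V.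
  by rewrite ler_pdivrMr //; apply: variance_ge.
have V0 : 0 < V by apply: lt_le_trans hV; rewrite divr_gt0 // mulr_gt0 // exprn_gt0.
pose s := Num.sqrt V; have s0 : 0 < s by rewrite sqrtr_gt0.
have sV : s ^+ 2 = V by rewrite sqr_sqrtr // ltW.
have ds0 : 0 < delta * s by rewrite mulr_gt0.
have sq_le (y z : R) : 0 < y -> 0 < z -> y ^+ 2 <= z ^+ 2 -> y <= z.
  by move=> y0 z0; rewrite ler_pXn2r ?nnegrE ?(ltW y0) ?(ltW z0).
have sL : mu / Phi * L <= s.
  apply: sq_le => //; first by rewrite mulr_gt0 ?divr_gt0.
  rewrite sV; apply: le_trans hV.
  have -> : (1 - p) * mu ^+ 2 / Phi = (mu / Phi) ^+ 2 * (Phi * (1 - p)).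
    by field; rewrite gt_eqF.
  by rewrite exprMn ler_wpM2l // sqr_ge0.
have epsds : eps * mu <= delta * s.
  apply: sq_le => //; first by rewrite mulr_gt0.
  rewrite !exprMn sV.
  apply: le_trans (ler_wpM2l (sqr_ge0 delta) hV).
  have -> : eps ^+ 2 * mu ^+ 2 = eps ^+ 2 * Phi / (1 - p) * ((1 - p) * mu ^+ 2 / Phi).
    by field; rewrite !gt_eqF.
  by rewrite ler_wpM2r // divr_ge0 ?mulr_ge0 ?sqr_ge0 // ltW.
have hS a : a \in copies EH H x -> a.2 \subset pairs n.
  by move=> ax; apply: (copies_pairs hH (full_sub_rooted hH) ax).
have hr a : a \in copies EH H x -> (#|a.2| <= #|new_edges EH H|)%N.
  by move=> ax; rewrite (copies_card hH (full_sub_rooted hH) ax).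
have sb := small_ball hp hS hr (near_bound hH hp xi Phi0) (leqnn 2) ds0.
rewrite -(muGH_mcount hH p xi) -/X' -/V in sb.
set Q := rsexpect _ _ (fun E => (`|X' E| < _)%R%:R) in sb.
have hQ : Q <= 4 * delta + ball_const / (delta * L).
  set m1 := rsexpect _ _ (fun E => `|X' E|) in sb.
  have hm1 : m1 <= s.
    rewrite -(@ler_pXn2r _ 2) ?nnegrE ?(ltW s0) //; last by apply: rsexpect_ge0.
    rewrite sV; apply: le_trans (sqr_ex_le _ _ hp) _; rewrite le_eqVlt; apply/orP; left; apply/eqP.
    by apply: eq_rsexpect => E _; rewrite real_normK ?num_real.
  set C : R := (stein_const _)%:R in sb; set B : R := (near_const _ _)%:R in sb.
  have C0 : 0 <= C by apply: ler0n.
  rewrite -(@ler_pM2l _ V) //; apply: le_trans sb _.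
  have -> : ball_const = 20 * C * B ^+ 2 by [].
  have t1 : delta * s * m1 <= delta * V.
    by rewrite -sV expr2 mulrA ler_wpM2l // ltW.
  have t2 : C * (1 - p) * mu * (B * (mu / Phi)) ^+ 2 / (delta * s) <=
      C * B ^+ 2 * (V / (delta * L)).
    have -> : C * (1 - p) * mu * (B * (mu / Phi)) ^+ 2 / (delta * s) =
       C * B ^+ 2 * ((1 - p) * mu ^+ 2 / Phi * (mu / Phi / (delta * s))).
      by field; rewrite !gt_eqF.
    apply: ler_wpM2l; first by rewrite mulr_ge0 ?sqr_ge0.
    apply: ler_pM => //; first by rewrite divr_ge0 ?mulr_ge0 ?sqr_ge0 // ltW.
      by rewrite !divr_ge0 // ltW.
    rewrite ler_pdivrMr // (_ : _ * (delta * s) = s / L); last first.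
      by field; rewrite !gt_eqF.
    by rewrite ler_pdivlMr.
  have -> : V * (4 * delta + 20 * C * B ^+ 2 / (delta * L)) =
     4 * (delta * V + 5 * (C * B ^+ 2 * (V / (delta * L)))) by ring.
  by rewrite -[5 * _ / _]mulrA; lra.
apply: le_trans (lerB (lexx 1) hQ) _; apply: gnp_prob_ge => // E sE.
rewrite negb_exists => /forallP/(_ x); rewrite negb_and -ltNge.
have -> : injectiveb x by apply/injectiveP.
by rewrite (XGH_ccount hH p xi sE) -/X' /= => h; rewrite (lt_le_trans h epsds).
Qed.

(** First moment method: Phi is the expected number of copies of the minimizing J. Without such a
    copy there is no copy of H, so the count is 0 and deviates by mu >= eps mu. *)
Lemma none_exists x (eps : R) : injective x -> 0 < eps <= 1 ->
  1 - Phi <=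
  gnp_prob p (fun E => [exists x : {ffun 'I_vG -> 'I_n}, injectiveb x && (eps * mu <= `|dev x E|)]).
Proof.
move=> xi /andP[eps0 eps1]; have [J hJ ->] := Phi_attained hH n p.
rewrite (mu_extE hH p hJ xi) -ex_copies //; apply: gnp_prob_ge; last first.
  by move=> E; apply: sumr_ge0 => al _; apply: ler0n.
move=> E sE; rewrite negb_exists => /forallP/(_ x); rewrite negb_and -ltNge.
have -> : injectiveb x by apply/injectiveP.
rewrite (XGH_ccount hH p xi sE) /= => h.
have [al /andP[ax aE]] : exists al, (al \in copies EH H x) && (al.2 \subset E).
  apply/existsP; apply: contraLR h; rewrite negb_exists => /forallP h; rewrite -leNgt.
  have -> : ccount p (copies EH H x) snd E = - mu.
    rewrite (muGH_mcount hH p xi) /ccount /mcount -sumrN; apply: eq_bigr => al ax.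
    by have := h al; rewrite ax /= /cind /ind => /negbTE ->; rewrite sub0r.
  by rewrite normrN ger0_norm ?(mu_ge0 xi) // ler_piMl // (mu_ge0 xi).
have [be [bx sb]] := subcopy hH hJ ax.
by rewrite (bigD1 be) //= (subset_trans sb aE) lerDl sumr_ge0 // => ? _; apply: ler0n.
Qed.

End Tails.

(** * Passage to the limit *)

Local Open Scope classical_set_scope.
Local Open Scope ring_scope.

Lemma cvg_to1 (R : realType) (P : nat -> R) : (forall n, P n <= 1) ->
  (forall e : R, 0 < e -> \forall n \near \oo, 1 - e <= P n) -> P @ \oo --> (1 : R).
Proof.
move=> P1 h; apply/cvgrPdist_le => e e0; near=> n.
rewrite ger0_norm ?subr_ge0 // lerBlDr -lerBlDl; near: n; exact: h.
Unshelve. all: by end_near.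
Qed.

Lemma inj_ffun_widen (k n : nat) : (k <= n)%N -> exists x : {ffun 'I_k -> 'I_n}, injective x.
Proof.
move=> kn; exists [ffun i => widen_ord kn i] => i j; rewrite !ffunE => /(congr1 val) /= e.
exact: val_inj.
Qed.

Theorem theorem9 (R : realType) (vG m : nat) (EH : {set {set 'I_(vG + m)}})
  (hH : rooted_graph EH) (p : nat -> R) (hp : forall n, 0 <= p n <= 1) :
  (forall t : nat -> R, (forall n, 0 < t n) ->
     (exists c : R, 0 < c /\ \forall n \near \oo, c <= PhiGH EH n (p n)) ->
     (exists c : R, 0 < c /\ \forall n \near \oo,
         (n%:R) `^ c <= (t n / muGH EH n (p n)) ^+ 2 * PhiGH EH n (p n)) ->
     (fun n => gnp_prob (p n) (fun Gam =>
        [forall x : {ffun 'I_vG -> 'I_n}, injectiveb x ==>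
           (`|XGH R EH x Gam - muGH EH n (p n)| < t n)])) @ \oo --> (1 : R))
  /\
  (forall eps : nat -> R, (forall n, 0 < eps n <= 1) ->
     ((((fun n => PhiGH EH n (p n) * (1 - p n)) @ \oo --> +oo) /\
       ((fun n => eps n ^+ 2 * PhiGH EH n (p n) / (1 - p n)) @ \oo --> (0 : R)))
      \/ ((fun n => PhiGH EH n (p n)) @ \oo --> (0 : R))) ->
     (fun n => gnp_prob (p n) (fun Gam =>
        [exists x : {ffun 'I_vG -> 'I_n}, injectiveb x &&
           (eps n * muGH EH n (p n) <= `|XGH R EH x Gam - muGH EH n (p n)|)])) @ \oo --> (1 : R)).
Proof.
split=> [t t0 [c [c0 hc]] [a [a0 ha]]|eps heps].
  apply: cvg_to1 => [n|e e0]; first exact: gnp_prob_le1.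
  (* A moment so high that n^(a(k+1)) >= n^(vG+1): this beats the at most n^vG tuples of the union
     bound and leaves a factor n to absorb C / e. *)
  pose k := Num.bound (vG.+1%:R / a).
  pose C := tail_const EH k c.
  have kP : vG.+1%:R <= a * k.+1%:R.
    have h : vG.+1%:R / a < k%:R by apply: archi_boundP; rewrite divr_ge0 ?ler0n // ltW.
    rewrite ltr_pdivrMr // in h; apply: (le_trans (ltW h)).
    by rewrite mulrC ler_wpM2l ?ler_nat // ltW.
  near=> n.
  have n0 : (0 < n)%N by near: n; exact: nbhs_infty_gt.
  have cPhi : c <= PhiGH EH n (p n) by near: n.
  have han : n%:R `^ a <= (t n / muGH EH n (p n)) ^+ 2 * PhiGH EH n (p n) by near: n.
  have hCn : C / e < n%:R by near: n; exact: nbhs_infty_gtr.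
  apply: le_trans (all_concentrated hH (hp n) k c0 cPhi (t0 n)); rewrite lerD2l lerN2 -/C.
  set z := _ * PhiGH _ _ _ in han *.
  have C0 : 0 <= C by apply: tail_const_ge0.
  have nR : 0 < n%:R :> R by rewrite ltr0n.
  have zk : n%:R ^+ vG.+1 <= z ^+ k.+1.
    apply: (@le_trans _ _ ((n%:R `^ a) ^+ k.+1)); last first.
      by apply: lerXn2r; rewrite ?nnegrE ?powR_ge0 // (le_trans (powR_ge0 _ _) han).
    rewrite -(@powR_mulrn R n%:R) ?ler0n // -(@powR_mulrn R (n%:R `^ a)) ?powR_ge0 //.
    rewrite -powRrM.
    by apply: ler_powR => //; rewrite ler1n.
  have zk0 : 0 < z ^+ k.+1 by apply: lt_le_trans zk; rewrite exprn_gt0.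
  rewrite mulrA ler_pdivrMr // natrX mulrC.
  rewrite ltr_pdivrMr // in hCn.
  apply: le_trans (ler_wpM2l (ltW e0) zk); rewrite exprS mulrA.
  by rewrite ler_wpM2r ?exprn_ge0 ?ler0n // mulrC ltW.
(* A tuple of distinct roots exists once n >= vG. *)
have vGn : \forall n \near \oo, exists x : {ffun 'I_vG -> 'I_n}, injective x.
  near=> n; apply: inj_ffun_widen; near: n; exact: nbhs_infty_ge.
case=> [[hinf hzero]|hzero]; apply: cvg_to1 => [n|e e0]; try exact: gnp_prob_le1.
  (* Then 4 delta = e / 2, and [L] is chosen to make the other error term at most e / 2; the summand
     1 in its numerator ensures [L > 0]. *)
  pose delta := e / 8; have d0 : 0 < delta by rewrite divr_gt0.
  have B0 : 0 <= ball_const R EH by rewrite !mulr_ge0 ?sqr_ge0 ?ler0n.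
  pose L := (ball_const R EH + 1) / (delta * (e / 2)).
  have L0 : 0 < L by rewrite divr_gt0 ?mulr_gt0 ?divr_gt0 // ltr_wpDl.
  near=> n.
  have [x xi] : exists x : {ffun 'I_vG -> 'I_n}, injective x by near: n.
  have hL : L ^+ 2 <= PhiGH EH n (p n) * (1 - p n).
    by apply: ltW; near: n; move/cvgryPgt : hinf; apply.
  have hd : eps n ^+ 2 * PhiGH EH n (p n) / (1 - p n) <= delta ^+ 2.
    apply: le_trans (ler_norm _) _; apply: ltW; near: n.
    by move/cvgr0Pnorm_lt : hzero; apply; rewrite exprn_gt0.
  have /andP[eps0 _] := heps n.
  apply: le_trans (one_deviates hH (hp n) xi eps0 d0 L0 hL hd); rewrite lerD2l lerN2.
  have h : ball_const R EH / (delta * L) <= e / 2.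
    rewrite ler_pdivrMr; last exact: mulr_gt0.
    have -> : e / 2 * (delta * L) = ball_const R EH + 1.
      by rewrite /L; field; rewrite !gt_eqF.
    by rewrite lerDl.
  by apply: le_trans (lerD (lexx _) h) _; rewrite /delta; lra.
near=> n.
have [x xi] : exists x : {ffun 'I_vG -> 'I_n}, injective x by near: n.
have hP : PhiGH EH n (p n) <= e.
  apply: le_trans (ler_norm _) _; apply: ltW; near: n.
  by move/cvgr0Pnorm_lt : hzero; apply.
by apply: le_trans (none_exists hH (hp n) xi (heps n)); rewrite lerD2l lerN2.
Unshelve. all: by end_near.
Qed.
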